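(* Let $n\ge 3$, $\lambda>-\frac{(n-2)^2}{4}$ and $2\kappa=n-2-\sqrt{(n-2)^2+4\lambda}$. Assume that $$0<\alpha<n,\qquad 2\kappa<n-2-\frac{2(n-2)}{3n-2+2\sqrt{9n^2+8n-16}},$$ and that $$\frac{\alpha}{2}-\frac{n+2+\sqrt{9n^2+8n-16}}{2}<\tau<\frac{\alpha}{2}-\max\Big\{\frac{n-4}{2},\ \frac{n-4}{n},\ \frac{\kappa}{n-2-2\kappa}-\frac n4\Big\}.$$ Let $p=1+\frac{2-2\tau+\alpha}{n-2}$, let $\varphi$ be a ground state, and let $u_0\in H^1_\lambda$ satisfy $$\frac{\mathcal E[u_0]}{\mathcal E[\varphi]}<1\qquad\text{and}\qquad \frac{\|\sqrt{\mathcal K_\lambda}u_0\|}{\|\sqrt{\mathcal K_\lambda}\varphi\|}<1 .$$ Then the maximal energy solution $u\in C([0,T^* );H^1_\lambda)$ of the focusing problem $$i\partial_t u-\mathcal K_\lambda u=-|x|^{-\tau}|u|^{p-2}\big(I_\alpha*|\cdot|^{-\tau}|u|^p\big)u,\qquad u(\cdot,0)=u_0,$$ is bounded in $H^1_\lambda$, i.e. $\sup_{t\in[0,T^* )}\|u(t)\|_{H^1_\lambda}<\infty$.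
   Context: $\|\cdot\|$ denotes the $L^2(\mathbb{R}^n)$ norm. $\mathcal K_\lambda=-\Delta+\frac{\lambda}{|x|^2}$ is the positive self-adjoint (Friedrichs) extension on $L^2(\mathbb{R}^n)$, so that $\|\sqrt{\mathcal K_\lambda}u\|^2=\|\nabla u\|^2+\lambda\||x|^{-1}u\|^2$. $H^1_\lambda$ and $W^{1,r}_\lambda$ are the completions of $C_0^\infty(\mathbb{R}^n)$ for the norms $\|\langle\sqrt{\mathcal K_\lambda}\rangle u\|_{L^2}$ and $\|\langle\sqrt{\mathcal K_\lambda}\rangle u\|_{L^r}$, with $\langle\cdot\rangle=(1+|\cdot|^2)^{1/2}$. The Riesz potential is $I_\alpha(x)=\frac{\Gamma(\frac{n-\alpha}{2})}{\Gamma(\frac\alpha2)\pi^{n/2}2^\alpha}|x|^{\alpha-n}$, $\mathcal P[u]=\int_{\mathbb{R}^n}|x|^{-\tau}\big(I_\alpha*|\cdot|^{-\tau}|u|^p\big)|u|^p\,dx$, and the (focusing) energy is $\mathcal E[u]=\|\sqrt{\mathcal K_\lambda}u\|^2-\frac1p\mathcal P[u]$. The standing assumption on the exponent is $p>2$. A ground state is a solution $0\ne\varphi\in H^1_\lambda$ of $-\Delta\varphi+\frac{\lambda}{|x|^2}\varphi=|x|^{-\tau}|\varphi|^{p-2}(I_\alpha*|\cdot|^{-\tau}|\varphi|^p)\varphi$ which minimizes $\|\sqrt{\mathcal K_\lambda}w\|^{2p}/\mathcal P[w]$ over $0\ne w\in H^1_\lambda$. Solutions are Duhamel solutions in the well-posedness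 class $C([0,T];H^1_\lambda)\cap L^q([0,T];W^{1,r}_\lambda)$ for every $T<T^*$ and every admissible pair $(q,r)$ (i.e. $2\le q\le\infty$, $2\le r\le\frac{2n}{n-2}$, $\frac2q+\frac nr=\frac n2$); they conserve mass $\|u(t)\|^2$ and energy $\mathcal E[u(t)]$; $[0,T^* )$ is the maximal forward interval of existence. *)

(* Defs.v *)
From HB Require Import structures.
From mathcomp Require Import all_boot all_order all_algebra.
From mathcomp Require Import all_classical all_reals all_analysis.
From mathcomp.real_closed Require Export complex.

Set Implicit Arguments.
Unset Strict Implicit.
Unset Printing Implicit Defensive.

Import Order.TTheory GRing.Theory Num.Theory.
Import numFieldNormedType.Exports.

Local Open Scope classical_set_scope.
Local Open Scope ring_scope.

Notation Rn R n := (n.-tuple (measurableTypeR R)).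

(** Lebesgue measure on R^n, as an iterated product: the measure on R^(n+1) is
    the image of [lebesgue_measure \x leb n] under (a, t) |-> a :: t. *)
Section LebesgueRn.
Context {R : realType}.

Definition tcons n (a : measurableTypeR R * Rn R n) : Rn R n.+1 :=
  [the n.+1.-tuple (measurableTypeR R) of a.1 :: a.2].

Definition tuncons n (t : Rn R n.+1) : measurableTypeR R * Rn R n :=
  (thead t, [tuple of behead t]).

Lemma measurable_tcons n : measurable_fun setT (@tcons n).
Proof. exact: measurable_cons. Qed.

Lemma measurable_tuncons n : measurable_fun setT (@tuncons n).
Proof.
apply/measurable_fun_pairP; split.
  exact: measurable_tnth.
exact: measurable_behead.
Qed.

Lemma tconsK n : cancel (@tcons n) (@tuncons n).
Proof. by case=> a t; congr pair; apply: val_inj. Qed.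

Section step.
Context (n : nat) (mu : {sigma_finite_measure set (Rn R n) -> \bar R}).

Definition leb_step : set (Rn R n.+1) -> \bar R :=
  pushforward (@lebesgue_measure R \x mu)%E (@tcons n).

Let mpre A : measurable A -> measurable (@tcons n @^-1` A).
Proof. by move=> mA; rewrite -[X in measurable X]setTI; exact: measurable_tcons. Qed.

Let leb_step0 : leb_step set0 = 0%E.
Proof. by rewrite /leb_step /pushforward preimage_set0 measure0. Qed.

Let leb_step_ge0 A : (0 <= leb_step A)%E.
Proof. by rewrite /leb_step /pushforward measure_ge0. Qed.

Let leb_step_sigma_additive : semi_sigma_additive leb_step.
Proof.
move=> F mF tF mUF; rewrite /leb_step /pushforward preimage_bigcup.
apply: measure_semi_sigma_additive.
- by move=> k; exact: mpre.
- apply/trivIsetP => /= i j _ _ ij; rewrite -preimage_setI.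
  by move/trivIsetP : tF => /(_ _ _ _ _ ij) ->//; rewrite preimage_set0.
- by rewrite -preimage_bigcup; exact: mpre.
Qed.

HB.instance Definition _ := isMeasure.Build _ _ _ leb_step
  leb_step0 leb_step_ge0 leb_step_sigma_additive.

Let leb_step_sigma_finite : sigma_finite setT leb_step.
Proof.
have /sigma_finiteP[F [TF ndF Foo]] := sigma_finiteT (@lebesgue_measure R).
have /sigma_finiteP[G [TG ndG Goo]] := sigma_finiteT mu.
exists (fun k => @tuncons n @^-1` (F k `*` G k)).
  apply/esym; rewrite -subTset => t _.
  have [k _ Fk] : (\bigcup_k F k) (tuncons t).1 by rewrite -TF.
  have [l _ Gl] : (\bigcup_k G k) (tuncons t).2 by rewrite -TG.
  exists (maxn k l) => //; split.
    by move: Fk; exact/subsetPset/ndF/leq_maxl.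
  by move: Gl; exact/subsetPset/ndG/leq_maxr.
move=> k; have [mF Fk] := Foo k; have [mG Gk] := Goo k; split.
  by rewrite -[X in measurable X]setTI; apply: measurable_tuncons => //; exact: measurableX.
rewrite /leb_step /pushforward.
have -> : @tcons n @^-1` (@tuncons n @^-1` (F k `*` G k)) = F k `*` G k.
  by rewrite -comp_preimage (_ : _ \o _ = id)//; apply/funext => x; exact: tconsK.
by rewrite product_measure1E// lte_mul_pinfty// ge0_fin_numE.
Qed.

HB.instance Definition _ := Measure_isSigmaFinite.Build _ _ _ leb_step
  leb_step_sigma_finite.

End step.

Fixpoint leb n : {sigma_finite_measure set (Rn R n) -> \bar R} :=
  match n with
  | 0%N => \d_ ([tuple] : Rn R 0)
  | m.+1 => leb_step (leb m)
  end.

End LebesgueRn.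

Section Functions.
Context {R : realType} {n : nat}.
Local Notation C := R[i].
Local Notation X := (Rn R n).
Local Notation cabs := Normc.normc.
Implicit Types (f g : X -> C) (x y : X).

Definition enorm x : R := Num.sqrt (\sum_(j < n) (tnth x j : R) ^+ 2).

Definition esub x y : X := [tuple (tnth x j : R) - (tnth y j : R) | j < n].

Definition cmeasurable f :=
  measurable_fun setT (fun x => complex.Re (f x)) /\
  measurable_fun setT (fun x => complex.Im (f x)).

Definition cintegral d (T : measurableType d) (mu : {measure set T -> \bar R})
    (D : set T) (f : T -> C) : C :=
  Complex (Rintegral mu D (fun s => complex.Re (f s)))
          (Rintegral mu D (fun s => complex.Im (f s))).

Definition Lpnorm (p : \bar R) f : \bar R :=
  Lnorm (leb n) p (fun x => (cabs (f x))%:E).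

Definition in_Lp (p : \bar R) f := cmeasurable f /\ (Lpnorm p f < +oo)%E.

Definition norm2 f : R := fine (Lpnorm 2%:E f).

Definition inner f g : C :=
  cintegral (leb n) setT (fun x => f x * ((g x)^*)%C).

Definition ae_equal f g :=
  ae_eq (leb n : {measure set X -> \bar R}) setT f g.

Definition over_abs f : X -> C := fun x => ((enorm x)^-1)%:C%C * f x.

(** Smoothness is expressed on 'rV[R]_n, which carries the normed space
    structure that tuples lack. *)
Definition tuple_of_row (v : 'rV[R]_n) : X := [tuple (v ord0 j : R) | j < n].
Definition row_of_tuple x : 'rV[R]_n := \row_(j < n) (tnth x j : R).

Definition partial (j : 'I_n) (h : 'rV[R]_n -> R) : 'rV[R]_n -> R :=
  fun v => derive h v (delta_mx ord0 j).

Definition smooth (h : 'rV[R]_n -> R) :=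
  forall (s : seq 'I_n) (v : 'rV[R]_n), differentiable (foldr partial h s) v.

Definition re_row f : 'rV[R]_n -> R := fun v => complex.Re (f (tuple_of_row v)).
Definition im_row f : 'rV[R]_n -> R := fun v => complex.Im (f (tuple_of_row v)).

Definition test_function f :=
  [/\ smooth (re_row f), smooth (im_row f) &
      exists M : R, forall x, M < enorm x -> f x = 0].

Definition grad f : 'I_n -> X -> C := fun j x =>
  Complex (partial j (re_row f) (row_of_tuple x))
          (partial j (im_row f) (row_of_tuple x)).

End Functions.

Section Form.
Context {R : realType} {n : nat}.
Local Notation C := R[i].
Local Notation X := (Rn R n).
Implicit Types (lam : R) (f g : X -> C) (G H : 'I_n -> X -> C).

(* ||sqrt K_lambda f||^2 = ||grad f||^2 + lam || f/|x| ||^2, with G = grad f *)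
Definition form lam f G : R :=
  \sum_(j < n) norm2 (G j) ^+ 2 + lam * norm2 (over_abs f) ^+ 2.

(* ||<sqrt K_lambda> f||^2 = ||f||^2 + ||sqrt K_lambda f||^2, with G = grad f *)
Definition h1sqr lam f G : R := norm2 f ^+ 2 + form lam f G.

(** H^1_lambda, the completion of C_0^oo: by Hardy's inequality (valid since
    lam > -(n-2)^2/4 in all uses) a Cauchy sequence [w] of test functions for
    the H^1_lambda norm is such that w, grad w and w/|x| converge in L^2; the
    class of [w] is represented by the limits of w and grad w. *)
Record H1 lam := MkH1 {
  h1val :> X -> C;
  h1grad : 'I_n -> X -> C;
  h1val_L2 : in_Lp 2%:E h1val;
  h1grad_L2 : forall j, in_Lp 2%:E (h1grad j);
  h1over_L2 : in_Lp 2%:E (over_abs h1val);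
  h1_completion : exists w : nat -> X -> C,
    [/\ forall k, test_function (w k),
        forall e : R, 0 < e -> exists N : nat, forall k l : nat,
          (N <= k)%N -> (N <= l)%N ->
          h1sqr lam (w k \- w l) (fun j => grad (w k) j \- grad (w l) j) < e,
        Lpnorm 2%:E (w k \- h1val) @[k --> \oo] --> 0%E,
        forall j, Lpnorm 2%:E (grad (w k) j \- h1grad j) @[k --> \oo] --> 0%E &
        Lpnorm 2%:E (over_abs (w k \- h1val)) @[k --> \oo] --> 0%E] }.

(* ||sqrt K_lambda u|| *)
Definition sqrtK_norm lam (u : H1 lam) : R := Num.sqrt (form lam u (h1grad u)).

Definition h1norm lam (u : H1 lam) : R := Num.sqrt (h1sqr lam u (h1grad u)).

Definition h1dist lam (u v : H1 lam) : R :=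
  Num.sqrt (h1sqr lam (u \- v) (fun j => h1grad u j \- h1grad v j)).

Definition h1eq lam (u v : H1 lam) :=
  ae_equal u v /\ forall j, ae_equal (h1grad u j) (h1grad v j).

Definition sesq lam (u v : H1 lam) : C :=
  \sum_(j < n) inner (h1grad u j) (h1grad v j)
  + lam%:C%C * inner (over_abs u) (over_abs v).

End Form.

Arguments H1 {R} n lam.

(** Unbounded operators on L^2, given by their graphs. *)
Section Operators.
Context {R : realType} {n : nat}.
Local Notation C := R[i].
Local Notation X := (Rn R n).
Local Notation L2 := (@in_Lp R n 2%:E).
Local Notation "f =ae g" := (ae_equal f g) (at level 70).
Implicit Types (lam : R) (f g h : X -> C).

Definition op := (X -> C) -> (X -> C) -> Prop.

Definition adjoint (A : op) : op := fun g h =>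
  [/\ L2 g, L2 h & forall f f', A f f' -> inner f' g = inner f h].

Definition densely_defined (A : op) := forall f (e : R), L2 f -> 0 < e ->
  exists g h, A g h /\ (Lpnorm 2%:E (f \- g)%R < e%:E)%E.

Definition selfadjoint (A : op) :=
  densely_defined A /\ forall g h, A g h <-> adjoint A g h.

Definition nonnegative (A : op) := forall f g, A f g -> 0 <= complex.Re (inner g f).

Definition add_id (A : op) : op := fun f g => A f (g \- f).

Definition is_sqrt (A S : op) :=
  [/\ selfadjoint S, nonnegative S &
      forall f h, (exists2 g, S f g & S g h) <-> A f h].

(** The Friedrichs extension K_lambda: the self-adjoint operator associated with
    the closure of the form on C_0^oo. *)
Definition Kop lam : op := fun f g =>
  [/\ L2 f, L2 g & exists2 u : H1 n lam, f =ae u &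
      forall v : H1 n lam, sesq u v = inner g v].

(* <sqrt K_lambda> = (1 + K_lambda)^(1/2) *)
Definition bracket_sqrtK lam : op := fun f g =>
  exists2 S, is_sqrt (add_id (Kop lam)) S & S f g.

(** [W1 lam r f g]: f belongs to W^{1,r}_lambda, the completion of C_0^oo for
    ||<sqrt K_lambda> w||_{L^r}, and g = <sqrt K_lambda> f in L^r, so that the
    W^{1,r}_lambda norm of f is the L^r norm of g. *)
Definition W1 lam (r : R) f g :=
  [/\ in_Lp r%:E f, in_Lp r%:E g & exists w z : nat -> X -> C,
    [/\ forall k, [/\ test_function (w k), bracket_sqrtK lam (w k) (z k) &
                      in_Lp r%:E (z k)],
        Lpnorm r%:E (w k \- f) @[k --> \oo] --> 0%E &
        Lpnorm r%:E (z k \- g) @[k --> \oo] --> 0%E]].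

(** [U t] = e^{-itK_lambda}, the strongly continuous unitary group with
    generator -iK_lambda (Stone's theorem). *)
Definition schrodinger_group lam (U : R -> (X -> C) -> X -> C) :=
  [/\ (forall t f, L2 f -> L2 (U t f) /\ norm2 (U t f) = norm2 f) /\
      (forall t (a : C) f g, L2 f -> L2 g ->
         U t (fun x => a * f x + g x) =ae (fun x => a * U t f x + U t g x)),
      forall f, L2 f -> U 0 f =ae f,
      forall s t f, L2 f -> U (s + t) f =ae U s (U t f),
      forall f, L2 f -> Lpnorm 2%:E (U t f \- f) @[t --> (0 : R)] --> 0%E &
      forall f g, L2 f -> L2 g ->
        (Kop lam f g <->
         Lpnorm 2%:E (fun x => (h^-1)%:C%C * (U h f x - f x) + 'i%C * g x)
           @[h --> (0 : R)^'] --> 0%E)].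

End Operators.

Section Choquard.
Context {R : realType} {n : nat}.
Local Notation C := R[i].
Local Notation X := (Rn R n).
Local Notation cabs := Normc.normc.
Local Notation dim := (n%:R : R).
Implicit Types (lam tau alpha p : R) (f g : X -> C) (x y : X).

Definition Gamma (s : R) : R :=
  Rintegral (@lebesgue_measure R) `]0, +oo[ (fun t : R => t `^ (s - 1) * expR (- t)).

Definition riesz alpha x : R :=
  Gamma ((dim - alpha) / 2) / (Gamma (alpha / 2) * pi `^ (dim / 2) * 2 `^ alpha)
  * enorm x `^ (alpha - dim).

(* I_alpha * (|.|^(-tau) |f|^p) *)
Definition potential tau alpha p f x : \bar R :=
  (\int[leb n]_y
     (riesz alpha (esub x y) * (enorm y `^ (- tau) * cabs (f y) `^ p))%:E)%E.

Definition Pfun tau alpha p f : \bar R :=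
  (\int[leb n]_x
     ((enorm x `^ (- tau) * cabs (f x) `^ p)%:E * potential tau alpha p f x))%E.

Definition nonlinearity tau alpha p f : X -> C := fun x =>
  (enorm x `^ (- tau) * cabs (f x) `^ (p - 2) *
   fine (potential tau alpha p f x))%:C%C * f x.

(* int |nonlinearity f| |g| dx *)
Definition abs_pairing tau alpha p f g : \bar R :=
  (\int[leb n]_x
     ((enorm x `^ (- tau) * cabs (f x) `^ (p - 2) * cabs (f x) * cabs (g x))%:E
      * potential tau alpha p f x))%E.

Definition energy lam tau alpha p (u : H1 n lam) : R :=
  sqrtK_norm u ^+ 2 - p^-1 * fine (Pfun tau alpha p u).

Definition nonzero f := ~ ae_equal f (cst 0).

(* the equation holds in the dual of H^1_lambda, the right-hand side being
   paired with H^1_lambda by an absolutely convergent integral *)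
Definition elliptic_solution lam tau alpha p (phi : H1 n lam) :=
  forall v : H1 n lam,
    (abs_pairing tau alpha p phi v < +oo)%E /\
    sesq phi v = inner (nonlinearity tau alpha p phi) v.

Definition quotient lam tau alpha p (w : H1 n lam) : \bar R :=
  ((sqrtK_norm w `^ (2 * p))%:E / Pfun tau alpha p w)%E.

Definition ground_state lam tau alpha p (phi : H1 n lam) :=
  [/\ nonzero phi, elliptic_solution tau alpha p phi &
      forall w : H1 n lam, nonzero w ->
        (quotient tau alpha p phi <= quotient tau alpha p w)%E].

End Choquard.

Section Evolution.
Context {R : realType} {n : nat}.
Local Notation C := R[i].
Local Notation X := (Rn R n).
Local Notation leb1 := (@lebesgue_measure R).
Local Notation dim := (n%:R : R).
Implicit Types (lam tau alpha p : R) (T : \bar R).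

Definition admissible (q : \bar R) (r : R) :=
  [/\ (2%:E <= q)%E, 2 <= r <= 2 * dim / (dim - 2) &
      (2%:E * q^-1 + (dim / r)%:E = (dim / 2)%:E)%E].

Definition simple_Lr (r : R) (G : R -> X -> C) :=
  exists (N : nat) (A : 'I_N -> set R) (g : 'I_N -> X -> C),
    (forall i, measurable (A i) /\ in_Lp r%:E (g i)) /\
    forall t x, G t x = \sum_(i < N) (\1_(A i) t)%:C%C * g i x.

Definition strongly_measurable_Lr (r b : R) (G : R -> X -> C) :=
  exists S : nat -> R -> X -> C, (forall k, simple_Lr r (S k)) /\
    \forall t \ae leb1, 0 <= t <= b ->
      Lpnorm r%:E (S k t \- G t) @[k --> \oo] --> 0%E.

(* u \in L^q([0,b]; W^{1,r}_lambda), where G = <sqrt K_lambda> u *)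
Definition LqW1 lam (q : \bar R) (r b : R) (u : R -> X -> C) :=
  exists G : R -> X -> C,
    [/\ \forall t \ae leb1, 0 <= t <= b -> W1 lam r (u t) (G t),
        strongly_measurable_Lr r b G &
        (Lnorm leb1 q
          (fun t => (\1_`[0, b] t)%:E * Lpnorm r%:E (G t)) < +oo)%E].

Definition lifespan T : set R := [set t | 0 <= t /\ (t%:E < T)%E].

(** u(t) = e^{-itK} u0 + i int_0^t e^{-i(t-s)K} nonlinearity(u(s)) ds in the
    dual of H^1_lambda, tested against v,
    using (e^{-i(t-s)K})^* = e^{-i(s-t)K}. *)
Definition duhamel lam tau alpha p (u0 : H1 n lam) T (u : R -> H1 n lam) :=
  exists2 U, schrodinger_group lam U &
  forall t, lifespan T t -> forall v : H1 n lam,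
    (\int[leb1]_(s in `[0%R, t]) abs_pairing tau alpha p (u s) (U (s - t)%R v)
       < +oo)%E /\
    inner (u t) v = inner (U t u0) v
      + 'i%C * cintegral leb1 `[0, t]
          (fun s => inner (nonlinearity tau alpha p (u s)) (U (s - t) v)).

(* conservation of mass and energy is part of the notion of solution *)
Definition energy_solution lam tau alpha p (u0 : H1 n lam) T
    (u : R -> H1 n lam) :=
  [/\ (0 < T)%E /\ h1eq (u 0) u0,
      forall t, lifespan T t ->
        h1dist (u s) (u t) @[s --> within (lifespan T) (nbhs t)] --> 0,
      forall b q r, lifespan T b -> admissible q r ->
        LqW1 lam q r b (fun t => u t),
      duhamel tau alpha p u0 T u &
      forall t, lifespan T t ->
        norm2 (u t) = norm2 u0 /\
        energy tau alpha p (u t) = energy tau alpha p u0].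

(* [0, T) is the maximal forward interval of existence of u *)
Definition maximal_solution lam tau alpha p (u0 : H1 n lam) T
    (u : R -> H1 n lam) :=
  energy_solution tau alpha p u0 T u /\
  forall T' v, (T < T')%E -> energy_solution tau alpha p u0 T' v ->
    ~ (forall t, lifespan T t -> h1eq (v t) (u t)).

End Evolution.

(* Main.v *)
Require Import Defs.
From mathcomp Require Import all_boot all_order all_algebra.
From mathcomp Require Import all_classical all_reals all_analysis.
From mathcomp Require Import measurable_realfun ring lra.

Import Order.TTheory GRing.Theory Num.Theory.
Import numFieldNormedType.Exports.

Local Open Scope classical_set_scope.
Local Open Scope ring_scope.

Set Implicit Arguments.
Unset Strict Implicit.
Unset Printing Implicit Defensive.

(** Testing the elliptic equation with the ground state [phi] gives
    [X := ||sqrt K phi||^2 = P[phi]], a finite positive number, so that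
    [E[phi] = (1 - 1/p) X > 0] and the minimized quotient is positive at [phi].
    Positivity of the quotient forces the quadratic form of K to be
    nonnegative on H^1_lambda; Cauchy-Schwarz then makes [||sqrt K u(t)||]
    continuous in [t].  If [||sqrt K w|| = ||sqrt K phi||], minimality gives
    [P[w] <= P[phi]], hence [E[w] >= E[phi]].  As the energy of [u(t)] stays
    below [E[phi]], the function [||sqrt K u(t)||^2], which starts below [X],
    can never cross [X]; together with mass conservation this bounds [u]. *)

(** * Positivity of Euler's Gamma function *)

Section Gamma.
Context {R : realType}.
Local Notation leb1 := (@lebesgue_measure R).
Implicit Types s t : R.

(* [t^(s-1) e^(-t) <= C (d/dt) (t / (1 + t))^s], and the primitive on the right is
   bounded, which gives convergence at 0 and at infinity at once. *)
Let dom s t := s * t `^ (s - 1) * (1 + t) `^ (- (s + 1)).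
Let prim s t := (1 - (1 + t)^-1) `^ s.

Let is_derive_prim s t : 0 < t -> is_derive t 1 (prim s) (dom s t).
Proof.
move=> t0.
have t1 : 0 < 1 + t by rewrite addr_gt0.
have q0 : 0 < 1 - (1 + t)^-1 by rewrite subr_gt0 invf_lt1// ltrDl.
have E : 1 - (1 + t)^-1 = t * (1 + t)^-1 by field; exact: lt0r_neq0.
have d1 : is_derive t 1 (fun t : R => 1 - (1 + t)^-1) ((1 + t) ^- 2).
  have d0 : is_derive t 1 (fun t : R => 1 + t) 1.
    have H := is_deriveD (is_derive_cst (1 : R) t 1) (is_derive_id t 1).
    by rewrite -[1 in X in is_derive _ _ _ X]add0r.
  have := @is_deriveV R _ _ _ _ (lt0r_neq0 t1) d0.
  move=> /(is_deriveB (is_derive_cst (1 : R) t 1)) H.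
  apply: (is_derive_eq H).
  by rewrite sub0r scaleNr opprK /GRing.scale/= mulr1.
have := @is_derive1_comp _ (fun y => y `^ s) (fun t => 1 - (1 + t)^-1) _ _ _
  (is_derive1_powR s q0) d1.
move=> H; apply: (is_derive_eq H).
(* By [E], the base [1 + t] carries the exponent [-(s - 1)] from the outer power and [-2] from the
   inner derivative, in total [-(s + 1)]. *)
rewrite /dom E powRM ?invr_ge0 ?ltW// -!mulrA; congr (_ * (_ * _)).
rewrite -powR_inv1 ?ltW// -powRrM -powR_invn ?ltW// -powRD.
  by congr (_ `^ _); lra.
by rewrite lt0r_neq0// implybT.
Qed.

Let continuous_dom s t : 0 < t -> {for t, continuous (dom s)}.
Proof.
move=> t0; have t1 : 0 < 1 + t by rewrite addr_gt0.
apply/differentiable_continuous/derivable1_diffP.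
have d0 : is_derive t 1 (fun t : R => 1 + t) 1.
  have H := is_deriveD (is_derive_cst (1 : R) t 1) (is_derive_id t 1).
  by rewrite -[1 in X in is_derive _ _ _ X]add0r.
have [D1 _] := @is_derive1_comp _ (fun y => y `^ (- (s + 1))) (fun t => 1 + t)
  _ _ _ (is_derive1_powR _ t1) d0.
have [D2 _] := is_derive1_powR (s - 1) t0.
exact: (derivableM (derivableM (derivable_cst s t 1) D2) D1).
Qed.

(** The integral is an increment of [prim], whose values at positive points lie between 0 and 1;
    hence a bound independent of [a] and [b]. *)
Let integral_dom_le1 s (a b : R) : 0 <= s -> 0 < a -> a < b ->
  (\int[leb1]_(t in `[a, b]) (dom s t)%:E <= 1)%E.
Proof.
move=> s0 a0 ab.
have pos t : t \in `[a, b] -> 0 < t.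
  by rewrite in_itv/= => /andP[at_ _]; exact: lt_le_trans at_.
rewrite (@continuous_FTC2 _ (dom s) (prim s))//.
- rewrite -EFinB lee_fin; apply: (@le_trans _ _ (prim s b)).
    by rewrite gerBl powR_ge0.
  have b0 := lt_trans a0 ab.
  rewrite /prim -[leRHS](congr1 (@^~ s) (powR1 R)); apply: ge0_ler_powR => //.
  + by rewrite nnegrE subr_ge0 invf_le1 ?lerDl ?addr_gt0// ltW.
  + by rewrite nnegrE ler01.
  + by rewrite gerBl invr_ge0 ltW// addr_gt0.
- apply: continuous_in_subspaceT => t /set_mem/= /pos; exact: continuous_dom.
- have cprim t : 0 < t -> {for t, continuous (prim s)}.
    by move=> /(is_derive_prim s)[/derivable1_diffP/differentiable_continuous].
  split.
  + by move=> t /subset_itv_oo_cc/pos/(is_derive_prim s)[].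
  + by apply: cvg_at_right_filter; exact/cprim.
  + by apply: cvg_at_left_filter; exact/cprim/(lt_trans a0).
- move=> t /subset_itv_oo_cc/pos/(is_derive_prim s) H.
  by rewrite derive1E; apply: derive_val.
Qed.

(** For [x >= 1] the exponent can be raised to the integer [m.+1], and that power divided by its
    factorial is a single term of the exponential series. *)
Lemma expR_ge_powR s : 0 <= s ->
  exists2 C : R, 0 < C & forall x, 1 <= x -> x `^ s <= C * expR x.
Proof.
move=> s0; pose m := (Num.trunc s).
exists (m.+1)`!%:R; first by rewrite ltr0n fact_gt0.
move=> x x1; have x0 : 0 <= x by exact: le_trans x1.
have sm : s <= m.+1%:R.
  by have /andP[_ /ltW] := truncn_itv s0.
apply: (le_trans (ler_powR x1 sm)); rewrite powR_mulrn//.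
have H := expR_ge1Dxn m x0; rewrite -ler_pdivrMl ?ltr0n ?fact_gt0//.
by rewrite mulrC; apply: le_trans H; rewrite lerDr.
Qed.

Let gint s t := t `^ (s - 1) * expR (- t).

Let gint_le_dom s : 0 < s ->
  exists2 C : R, 0 < C & forall t, 0 < t -> gint s t <= C * dom s t.
Proof.
move=> s0.
have [|C C0 H] := @expR_ge_powR (s + 1); first by rewrite addr_ge0// ltW.
(* [C] comes from the comparison at the point [1 + t], [expR 1] from splitting [expR (1 + t)], and
   dividing by [s] cancels the leading factor of [dom]. *)
exists (C * expR 1 / s); first by rewrite divr_gt0// mulr_gt0// expR_gt0.
move=> t t0; have t1 : 1 <= 1 + t by rewrite lerDl ltW.
rewrite /gint /dom !mulrA divfK ?gt_eqF//.
rewrite [leRHS]mulrAC [leRHS]mulrC ler_wpM2l ?powR_ge0//.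
rewrite expRN powRN ler_pdivlMr ?powR_gt0 ?addr_gt0//.
rewrite mulrC ler_pdivrMr ?expR_gt0// -mulrA -expRD.
exact: H.
Qed.

(** [Rintegral] turns an infinite integral into 0, so convergence must be settled before
    positivity. *)
Lemma Gamma_gt0 s : 0 < s -> 0 < Gamma s.
Proof.
move=> s0; have [C C0 HC] := gint_le_dom s0.
have mg (D : set R) : measurable D -> measurable_fun D (EFin \o gint s).
  move=> mD; apply: measurableT_comp => //; apply: measurable_funTS.
  apply: measurable_funM; first exact: measurable_powR.
  by apply: measurableT_comp => //; exact: measurableT_comp.
have mdom (D : set R) : measurable D -> measurable_fun D (EFin \o dom s).
  move=> mD; apply: measurableT_comp => //; apply: measurable_funTS.
  apply: measurable_funM; last first.
    apply: (measurableT_comp (measurable_powR _)).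
    by apply: measurable_funD.
  by apply: measurable_funM => //; exact: measurable_powR.
have g0 t : 0 <= gint s t by rewrite mulr_ge0 ?powR_ge0 ?expR_ge0.
have d0 t : 0 <= dom s t by rewrite !mulr_ge0 ?powR_ge0 ?ltW.
(* These compact intervals exhaust the half-line. The added 1 on the right keeps the interval for
   [k = 0] nondegenerate, as [integral_dom_le1] asks for [a < b]. *)
pose F (k : nat) : set R := `[k.+1%:R^-1, k.+1%:R + 1]%classic.
have FP k t : F k t -> 0 < t.
  rewrite /F/= in_itv/= => /andP[+ _]; apply: lt_le_trans.
  by rewrite invr_gt0.
have UF : \bigcup_k F k = `]0, +oo[%classic.
  apply/seteqP; split=> [t [k _ /FP]|t]; rewrite /= in_itv/= andbT// => t0.
  pose m := maxn (Num.trunc t) (Num.trunc t^-1).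
  exists m => //; rewrite /F /= in_itv/=; apply/andP; split.
    rewrite invf_ple ?posrE//; apply: ltW.
    have /truncn_itv/andP[_ /lt_le_trans] : 0 <= t^-1 by rewrite invr_ge0 ltW.
    by apply; rewrite ler_nat ltnS leq_maxr.
  have /andP[_ /ltW/le_trans] := truncn_itv (ltW t0); apply.
  apply: (@le_trans _ _ m.+1%:R); first by rewrite ler_nat ltnS leq_maxl.
  by rewrite lerDl.
have ndF : nondecreasing_seq F.
  move=> k l kl; apply/subsetPset => t; rewrite /F/= !in_itv/= => /andP[a b].
  apply/andP; split.
    by apply: le_trans a; rewrite lef_pV2 ?posrE// ler_nat.
  by apply: (le_trans b); rewrite lerD2r ler_nat.
have fin : (\int[leb1]_(t in `]0%R, +oo[) (gint s t)%:E <= C%:E)%E.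
  rewrite -UF.
  have mF i : measurable (F i) by exact: measurable_itv.
  have gF i x : F i x -> (0 <= (gint s x)%:E)%E by rewrite lee_fin.
  have := @ge0_nondecreasing_set_cvg_integral _ (measurableTypeR R) R F
    (fun t => (gint s t)%:E) leb1 ndF mF (fun i => mg _ (mF i)) gF.
  move=> /[dup] cg /cvg_lim <-//; apply: lime_le; first by apply/cvg_ex; eexists; exact: cg.
  apply: nearW => k.
  apply: (@le_trans _ _ (\int[leb1]_(t in F k) (C%:E * (dom s t)%:E))%E).
    apply: ge0_le_integral.
    + exact: mF.
    + exact: gF.
    + exact: mg.
    + by apply: measurable_funeM; exact: mdom.
    + by move=> x /FP /HC; rewrite -EFinM lee_fin.
  rewrite ge0_integralZl//; last 4 first.
  - exact: mF.
  - exact: mdom.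
  - by move=> x _; rewrite lee_fin.
  - by rewrite lee_fin ltW.
  rewrite -[leRHS]mule1; apply: lee_wpmul2l; first by rewrite lee_fin ltW.
  apply: integral_dom_le1; rewrite ?(ltW s0) ?invr_gt0//.
  by rewrite (@le_lt_trans _ _ 1) ?invf_le1 ?ler1n// ltrDr.
have ge0 : (0 <= \int[leb1]_(t in `]0%R, +oo[) (gint s t)%:E)%E.
  by apply: integral_ge0 => t _; rewrite lee_fin.
rewrite lt_neqAle /Gamma /Rintegral fine_ge0// andbT eq_sym fine_eq0; last first.
  by rewrite ge0_fin_numE// (le_lt_trans fin)// ltry.
(* A zero integral would make the integrand vanish almost everywhere, yet it is positive on all of
   [[1, 2]], which has measure 1. *)
apply/eqP => I0.
have : ae_eq leb1 `]0, +oo[%classic (fun t => (gint s t)%:E) (cst 0%E).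
  apply/ae_eq_integral_abs => //; first exact: mg.
  rewrite -[RHS]I0; apply: eq_integral => x _.
  by rewrite /= ger0_norm.
move=> [N [mN N0 sub]].
have : (leb1 `[1%R, 2%R] <= leb1 N)%E.
  apply: le_measure; rewrite ?inE//.
  apply: subset_trans sub => t; rewrite /= in_itv/= => /andP[t1 _].
  have t0 : 0 < t by exact: lt_le_trans t1.
  move=> /(_ _); rewrite in_itv/= andbT => /(_ t0) [] /eqP.
  by rewrite gt_eqF// mulr_gt0 ?powR_gt0 ?expR_gt0.
rewrite [X in (_ <= X)%E]N0 lebesgue_measure_itv/= lte_fin ltr1n/= -EFinB lee_fin.
by rewrite leNgt -[2]/(1 + 1) addrK ltr01.
Qed.
End Gamma.

(** * Quadratic forms on L^2 *)

Section L2.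
Context {R : realType} {n : nat}.
Local Notation C := R[i].
Local Notation X := (Rn R n).
Local Notation cabs := Normc.normc.
Local Notation mu := (leb n : {sigma_finite_measure set X -> \bar R}).
Local Notation L2 := (@in_Lp R n 2%:E).
Implicit Types (f g : X -> C) (a b : R).

Lemma normc_ge0 (z : C) : 0 <= cabs z.
Proof. by case: z => x y; exact: sqrtr_ge0. Qed.

Lemma sqr_normcE (z : C) :
  cabs z ^+ 2 = complex.Re z ^+ 2 + complex.Im z ^+ 2.
Proof. by case: z => x y /=; rewrite sqr_sqrtr// addr_ge0 ?sqr_ge0. Qed.

(** Kept in the extended reals, so that finiteness can be expressed: [norm2] goes through [fine] and
    gives 0 for an infinite norm. *)
Definition sqnorm f : \bar R := (\int[mu]_x (cabs (f x) ^+ 2)%:E)%E.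

Lemma sqnorm_ge0 f : (0 <= sqnorm f)%E.
Proof. by apply: integral_ge0 => x _; rewrite lee_fin sqr_ge0. Qed.

Lemma Lpnorm2E f : Lpnorm 2%:E f = (sqnorm f `^ 2^-1)%E.
Proof.
rewrite /Lpnorm unlock /=; congr (_ `^ _)%E; apply: eq_integral => x _.
rewrite ger0_norm ?normc_ge0//.
by rewrite -powR_mulrn ?normc_ge0.
Qed.

Lemma sqr_Lpnorm2 f : (Lpnorm 2%:E f `^ 2 = sqnorm f)%E.
Proof. by rewrite Lpnorm2E -poweRrM mulVf// poweRe1// sqnorm_ge0. Qed.

(** True without integrability, since [fine] sends an infinite value to 0 on both sides. *)
Lemma sqr_norm2 f : norm2 f ^+ 2 = fine (sqnorm f).
Proof.
rewrite /norm2 -sqr_Lpnorm2.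
have : (0 <= Lpnorm 2%:E f)%E by exact: Lnorm_ge0.
case: (Lpnorm _ _) => [r| |]//= r0; last first.
  by rewrite pnatr_eq0 expr0n.
by rewrite powR_mulrn// -lee_fin.
Qed.

Lemma in_L2P f : L2 f <-> cmeasurable f /\ (sqnorm f < +oo)%E.
Proof.
rewrite /in_Lp Lpnorm2E; split=> -[mf sf]; split => //; last exact: poweR_lty.
rewrite ltey; apply/eqP => E; move: sf; rewrite E poweRyr//.
Qed.

Lemma measurable_normc f : cmeasurable f -> measurable_fun setT (fun x => cabs (f x)).
Proof.
move=> [mr mi].
have -> : (fun x => cabs (f x)) =
    Num.sqrt \o (fun x => complex.Re (f x) ^+ 2 + complex.Im (f x) ^+ 2).
  by apply/funext => x /=; case: (f x).
apply: measurableT_comp.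
  by apply: continuous_measurable_fun; exact: sqrt_continuous.
by apply: measurable_funD; exact: measurable_funX.
Qed.

Lemma measurable_sqr_normc f : cmeasurable f ->
  measurable_fun setT (fun x => (cabs (f x) ^+ 2)%:E).
Proof.
move=> mf; apply: measurableT_comp => //; apply: measurable_funX.
exact: measurable_normc.
Qed.

Lemma sqnorm_ae_eq f g : cmeasurable f -> cmeasurable g -> ae_equal f g ->
  sqnorm f = sqnorm g.
Proof.
move=> mf mg [N [mN N0 sub]]; apply: ge0_ae_eq_integral => //.
- exact: measurable_sqr_normc.
- exact: measurable_sqr_normc.
- by move=> x _; rewrite lee_fin sqr_ge0.
- by move=> x _; rewrite lee_fin sqr_ge0.
exists N; split => // x /= H; apply: sub => /= H'; apply: H => _.
by rewrite H'.
Qed.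

(** The coefficients are real because the discriminant argument varies two real parameters; real and
    imaginary parts then combine separately. *)
Definition lincomb {T : Type} a b (f g : T -> C) : T -> C :=
  fun x => (a%:C * f x + b%:C * g x)%C.

Lemma Re_lincomb T a b (f g : T -> C) x :
  complex.Re (lincomb a b f g x) = a * complex.Re (f x) + b * complex.Re (g x).
Proof. by rewrite /lincomb; case: (f x) => p q; case: (g x) => r s /=; ring. Qed.

Lemma Im_lincomb T a b (f g : T -> C) x :
  complex.Im (lincomb a b f g x) = a * complex.Im (f x) + b * complex.Im (g x).
Proof. by rewrite /lincomb; case: (f x) => p q; case: (g x) => r s /=; ring. Qed.

Lemma subf_lincomb T (f g : T -> C) : f \- g = lincomb 1 (-1) f g.
Proof.
apply/funext => x; apply/eqP; rewrite eq_complex Re_lincomb Im_lincomb /=.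
by case: (f x) => p q; case: (g x) => r s /=; rewrite !mul1r !mulN1r !eqxx.
Qed.

Lemma over_abs_lincomb a b f g :
  over_abs (lincomb a b f g) = lincomb a b (over_abs f) (over_abs g).
Proof.
by apply/funext => x; rewrite /over_abs /lincomb mulrDr !(mulrCA (_^-1)%:C%C).
Qed.

Lemma cmeasurable_lincomb a b f g : cmeasurable f -> cmeasurable g ->
  cmeasurable (lincomb a b f g).
Proof.
move=> [fr fi] [gr gi]; split.
- under eq_fun do rewrite Re_lincomb.
  by apply: measurable_funD; exact: measurable_funM.
- under eq_fun do rewrite Im_lincomb.
  by apply: measurable_funD; exact: measurable_funM.
Qed.

(** Pointwise this is [(x + y)^2 <= 2 x^2 + 2 y^2], a consequence of [(x - y)^2 >= 0], applied to
    real and imaginary parts. *)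
Lemma sqnorm_lincomb_le a b f g : cmeasurable f -> cmeasurable g ->
  (sqnorm (lincomb a b f g) <=
   (2 * a ^+ 2)%:E * sqnorm f + (2 * b ^+ 2)%:E * sqnorm g)%E.
Proof.
move=> mf mg.
have c0 (c : R) : 0 <= 2 * c ^+ 2 by rewrite mulr_ge0 ?sqr_ge0.
have m2 (c : R) (h : X -> C) : cmeasurable h ->
    measurable_fun setT (fun x => ((2 * c ^+ 2)%:E * (cabs (h x) ^+ 2)%:E)%E).
  by move=> mh; apply: measurable_funeM; exact: measurable_sqr_normc.
rewrite /sqnorm -!ge0_integralZl//; try by
  [exact: measurable_sqr_normc|move=> x _; rewrite lee_fin sqr_ge0|rewrite lee_fin].
rewrite -ge0_integralD//; try by
  [exact: m2|move=> x _; rewrite -EFinM lee_fin mulr_ge0 ?sqr_ge0].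
apply: ge0_le_integral => //.
- by move=> x _; rewrite lee_fin sqr_ge0.
- by apply: measurable_sqr_normc; apply: cmeasurable_lincomb.
- by apply: emeasurable_funD; exact: m2.
move=> x _; rewrite -!EFinM -EFinD lee_fin !sqr_normcE Re_lincomb Im_lincomb.
set p := complex.Re _; set q := complex.Re _.
set r := complex.Im _; set s := complex.Im _.
have := sqr_ge0 (a * p - b * q); have := sqr_ge0 (a * r - b * s); nra.
Qed.

Lemma in_L2_lincomb a b f g : L2 f -> L2 g -> L2 (lincomb a b f g).
Proof.
move=> /in_L2P[mf sf] /in_L2P[mg sg]; apply/in_L2P; split.
  exact: cmeasurable_lincomb.
apply: (le_lt_trans (sqnorm_lincomb_le _ _ _ _)) => //.
by rewrite lte_add_pinfty// lte_mul_pinfty// lee_fin mulr_ge0 ?sqr_ge0.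
Qed.

(** The real part of [f] times the conjugate of [g], which is the cross term in the squared modulus
    of a real combination. *)
Definition rdot f g x : R :=
  complex.Re (f x) * complex.Re (g x) + complex.Im (f x) * complex.Im (g x).

Lemma integrable_sqr_normc f : L2 f ->
  mu.-integrable setT (fun x => (cabs (f x) ^+ 2)%:E).
Proof.
move=> /in_L2P[mf sf]; apply/integrableP; split; first exact: measurable_sqr_normc.
rewrite (le_lt_trans _ sf)// le_eqVlt; apply/orP; left; apply/eqP.
by apply: eq_integral => x _; rewrite /= ger0_norm ?sqr_ge0.
Qed.

Lemma integrable_rdot f g : L2 f -> L2 g ->
  mu.-integrable setT (fun x => (rdot f g x)%:E).
Proof.
move=> f2 g2.
have [[[fr fi] _] [[gr gi] _]] := (f2, g2).
apply: (@le_integrable _ _ _ mu setT measurableT _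
  (fun x => (cabs (f x) ^+ 2)%:E + (cabs (g x) ^+ 2)%:E)%E).
- apply: measurableT_comp => //.
  by apply: measurable_funD; exact: measurable_funM.
- move=> x _; rewrite -EFinD /= lee_fin [leRHS]ger0_norm ?addr_ge0 ?sqr_ge0//.
  rewrite /rdot !sqr_normcE ler_norml; apply/andP; split.
    set p := complex.Re _; set q := complex.Re _.
    set r := complex.Im _; set s := complex.Im _.
    have := sqr_ge0 (p + q); have := sqr_ge0 (r + s).
    have := sqr_ge0 p; have := sqr_ge0 q; have := sqr_ge0 r; have := sqr_ge0 s; nra.
  set p := complex.Re _; set q := complex.Re _.
  set r := complex.Im _; set s := complex.Im _.
  have := sqr_ge0 (p - q); have := sqr_ge0 (r - s).
  have := sqr_ge0 p; have := sqr_ge0 q; have := sqr_ge0 r; have := sqr_ge0 s; nra.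
- by apply: integrableD => //; exact: integrable_sqr_normc.
Qed.

Definition dot f g : R := Rintegral mu setT (rdot f g).

Lemma sqr_norm2_lincomb a b f g : L2 f -> L2 g ->
  norm2 (lincomb a b f g) ^+ 2 =
  a ^+ 2 * norm2 f ^+ 2 + 2 * a * b * dot f g + b ^+ 2 * norm2 g ^+ 2.
Proof.
move=> f2 g2; rewrite !sqr_norm2.
have If := integrable_sqr_normc f2; have Ig := integrable_sqr_normc g2.
have Ifg := integrable_rdot f2 g2.
rewrite -[fine (sqnorm f)]/(Rintegral mu setT (fun x => cabs (f x) ^+ 2)).
rewrite -[fine (sqnorm g)]/(Rintegral mu setT (fun x => cabs (g x) ^+ 2)).
have IZ c (h : X -> R) : mu.-integrable setT (EFin \o h) ->
    mu.-integrable setT (EFin \o (fun x => c * h x)).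
  by move=> /(integrableZl measurableT c); apply: eq_integrable.
rewrite /dot -!RintegralZl// -!RintegralD//; try exact: IZ; last first.
  by apply: (@eq_integrable _ _ _ _ _ measurableT _ _ _
    (integrableD measurableT (IZ _ _ If) (IZ _ _ Ifg))).
rewrite /sqnorm; apply: eq_Rintegral => x _.
rewrite !sqr_normcE Re_lincomb Im_lincomb /rdot; ring.
Qed.

Variable lam : R.
Implicit Types F G : 'I_n -> X -> C.

Definition form_dot f g F G : R :=
  \sum_(j < n) dot (F j) (G j) + lam * dot (over_abs f) (over_abs g).

(** Written as a quadratic polynomial in [a] and [b], the form falls under [discriminant_le]. *)
Lemma form_lincomb a b f g F G : L2 (over_abs f) -> L2 (over_abs g) ->
  (forall j, L2 (F j)) -> (forall j, L2 (G j)) ->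
  Defs.form lam (lincomb a b f g) (fun j => lincomb a b (F j) (G j)) =
  a ^+ 2 * Defs.form lam f F + 2 * a * b * form_dot f g F G + b ^+ 2 * Defs.form lam g G.
Proof.
move=> f2 g2 F2 G2; rewrite /Defs.form /form_dot over_abs_lincomb sqr_norm2_lincomb//.
under eq_bigr do rewrite sqr_norm2_lincomb//.
rewrite !big_split/= -!mulr_sumr; ring.
Qed.

(** A solution attains its initial datum only up to [h1eq]; this carries the value of the form over
    to time 0. *)
Lemma h1eq_form (u v : H1 n lam) : h1eq u v ->
  Defs.form lam u (h1grad u) = Defs.form lam v (h1grad v).
Proof.
move=> [uv duv]; rewrite /Defs.form; congr (_ + lam * _).
  apply: eq_bigr => j _; rewrite !sqr_norm2; congr fine.
  by apply: sqnorm_ae_eq => //; [have [] := h1grad_L2 u j|have [] := h1grad_L2 v j].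
rewrite !sqr_norm2; congr fine; apply: sqnorm_ae_eq.
- by have [] := h1over_L2 u.
- by have [] := h1over_L2 v.
have [N [mN N0 sub]] := uv; exists N; split => // x /= H; apply: sub => /= H'.
by apply: H => _; rewrite /over_abs H'.
Qed.
End L2.

(** * Measurability of test functions *)

Section ContinuousMeasurable.
Context {R : realType} {n : nat}.
Local Notation X := (Rn R n).

(* h is the pointwise limit of its values at the grid points
   floor((k+1)x)/(k+1), and only countably many of these occur for each k. *)
Lemma measurable_continuous_row (h : 'rV[R]_n -> R) : continuous h ->
  measurable_fun [set: X] (h \o row_of_tuple).
Proof.
move=> ch.
pose grid k (z : 'I_n -> int) : 'rV[R]_n := \row_j ((z j)%:~R / k.+1%:R).
pose cell k (x : X) : {ffun 'I_n -> int} :=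
  [ffun j => Num.floor (k.+1%:R * (tnth x j : R))].
apply: (@measurable_fun_cvg _ _ _ setT (fun k x => h (grid k (cell k x)))).
  move=> k _ A mA; rewrite setTI.
  (* The grid value depends on [x] only through its cell, so the preimage is a countable union of
     half-open boxes, one for each admissible [z]. *)
  have -> : (fun x => h (grid k (cell k x))) @^-1` A =
      \bigcup_(z : {ffun 'I_n -> int}) (if h (grid k z) \in A then
        \bigcap_(j in [set: 'I_n])
          ((fun x : X => k.+1%:R * (tnth x j : R)) @^-1`
             `[(z j)%:~R, (z j + 1)%:~R[%classic) else set0).
    apply/seteqP; split=> [x /= Ax|x [z _]].
      exists (cell k x) => //; rewrite mem_set// => j _ /=.
      by rewrite in_itv/= ffunE; exact: floor_itv.
    case: ifPn => // /set_mem Az zx /=.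
    rewrite (_ : cell k x = z)//; apply/ffunP => j; rewrite ffunE.
    by have := zx j I; rewrite /= in_itv/= => /floor_def.
  apply: countable_bigcupT_measurable => // z.
  case: ifPn => // _; apply: fin_bigcap_measurable => // j _.
  rewrite -[X in measurable X]setTI.
  have mj : measurable_fun [set: X] (fun x : X => k.+1%:R * (tnth x j : R)).
    by apply: measurable_funM => //; exact: measurable_tnth.
  by apply: mj => //; exact: measurable_itv.
move=> x _; apply: (@cvg_comp _ _ _ (fun k => grid k (cell k x)) h
  _ (nbhs (row_of_tuple x))); last exact: ch.
apply/cvg_ballP => e e0; near=> k; split=> // i j.
rewrite /ball/= /ball_ !mxE !ffunE.
have k0 : 0 < k.+1%:R :> R by [].
set t : R := tnth x j; have /andP[fl fu] := floor_itv (k.+1%:R * t).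
have -> : t - (Num.floor (k.+1%:R * t))%:~R / k.+1%:R =
    (k.+1%:R * t - (Num.floor (k.+1%:R * t))%:~R) / k.+1%:R.
  by rewrite mulrBl mulrAC divff ?mul1r// gt_eqF.
rewrite ger0_norm ?divr_ge0 ?subr_ge0//.
apply: (@le_lt_trans _ _ k.+1%:R^-1).
  rewrite -[leRHS]mul1r ler_pM2r ?invr_gt0// lerBlDr addrC ltW//.
  by move: fu; rewrite intrD.
near: k; exact: near_infty_natSinv_lt (PosNum e0).
Unshelve. all: by end_near. Qed.

Lemma tuple_of_rowK : cancel (@row_of_tuple R n) tuple_of_row.
Proof.
by move=> x; apply: eq_from_tnth => j; rewrite tnth_mktuple mxE.
Qed.

Lemma partial_lincomb (a b : R) (h k : 'rV[R]_n -> R) j :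
  (forall v, differentiable h v) -> (forall v, differentiable k v) ->
  partial j (fun v => a * h v + b * k v) =
  (fun v => a * partial j h v + b * partial j k v).
Proof.
move=> dh dk; apply/funext => v; rewrite /partial.
have dh' : derivable h v (delta_mx ord0 j) by exact: diff_derivable.
have dk' : derivable k v (delta_mx ord0 j) by exact: diff_derivable.
rewrite -[X in derive X _ _]/((a \*: h) + (b \*: k)) deriveD; first last.
- exact: derivableZ.
- exact: derivableZ.
by rewrite !deriveZ.
Qed.

(** Iterated partial derivatives commute with linear combinations, by induction on the list; each
    step uses the differentiability of the previous iterates. *)
Lemma smooth_lincomb (a b : R) (h k : 'rV[R]_n -> R) : smooth h -> smooth k ->
  smooth (fun v => a * h v + b * k v).
Proof.
move=> sh sk s; suff -> : foldr partial (fun v => a * h v + b * k v) s =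
    (fun v => a * foldr partial h s v + b * foldr partial k s v).
  move=> v.
  by apply: (@differentiableD _ _ _ (a \*: foldr partial h s)
    (b \*: foldr partial k s)); apply: differentiableZ; [exact: sh|exact: sk].
elim: s => //= j s ->; rewrite partial_lincomb//.
Qed.

Lemma cmeasurable_test_function (w : X -> R[i]) : test_function w -> cmeasurable w.
Proof.
move=> [sr si _]; split.
- have -> : (fun x => complex.Re (w x)) = re_row w \o row_of_tuple.
    by apply/funext => x; rewrite /re_row /= tuple_of_rowK.
  apply: measurable_continuous_row => v.
  exact: differentiable_continuous (sr [::] v).
- have -> : (fun x => complex.Im (w x)) = im_row w \o row_of_tuple.
    by apply/funext => x; rewrite /im_row /= tuple_of_rowK.
  apply: measurable_continuous_row => v.
  exact: differentiable_continuous (si [::] v).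
Qed.

Lemma cmeasurable_grad (w : X -> R[i]) j : test_function w -> cmeasurable (grad w j).
Proof.
move=> [sr si _]; split.
- apply: measurable_continuous_row => v.
  exact: differentiable_continuous (sr [:: j] v).
- apply: measurable_continuous_row => v.
  exact: differentiable_continuous (si [:: j] v).
Qed.

Lemma measurable_enorm : measurable_fun [set: X] enorm.
Proof.
rewrite /enorm; apply: (@measurableT_comp _ _ _ _ _ _ (@Num.sqrt R)).
  by apply: continuous_measurable_fun; exact: sqrt_continuous.
by apply: measurable_sum => j; apply: measurable_funX; exact: measurable_tnth.
Qed.

Lemma cmeasurable_over_abs (f : X -> R[i]) : cmeasurable f -> cmeasurable (over_abs f).
Proof.
have mi : measurable_fun [set: X] (fun x => (enorm x)^-1).
  (* Measurability of the inverse is read off that of real powers; at the origin both expressions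
     are 0 by convention. *)
  have -> : (fun x : X => (enorm x)^-1) = (fun t : R => t `^ (- 1)) \o enorm.
    by apply/funext => x /=; rewrite powR_inv1// sqrtr_ge0.
  by apply: measurableT_comp; [exact: measurable_powR|exact: measurable_enorm].
move=> [mr mim]; split.
- have -> : (fun x => complex.Re (over_abs f x)) =
      (fun x => (enorm x)^-1 * complex.Re (f x)).
    by apply/funext => x; rewrite /over_abs; case: (f x) => p q /=; rewrite mul0r subr0.
  exact: measurable_funM.
- have -> : (fun x => complex.Im (over_abs f x)) =
      (fun x => (enorm x)^-1 * complex.Im (f x)).
    by apply/funext => x; rewrite /over_abs; case: (f x) => p q /=; rewrite mul0r addr0.
  exact: measurable_funM.
Qed.

End ContinuousMeasurable.

(** * H^1_lambda is closed under real linear combinations *)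

Section H1closed.
Context {R : realType} {n : nat}.
Local Notation C := R[i].
Local Notation X := (Rn R n).
Local Notation L2 := (@in_Lp R n 2%:E).
Implicit Types (f g : X -> C) (a b : R).

(** An eventual bound by 1 makes the terms finite, which reduces the limit to one of real
    numbers. *)
Lemma ge0_cvge0P (u : nat -> \bar R) : (forall k, (0 <= u k)%E) ->
  u k @[k --> \oo] --> 0%E <->
  forall e : R, 0 < e -> \forall k \near \oo, (u k < e%:E)%E.
Proof.
move=> u0; split=> [/fine_cvgP[ufin /cvgrPdist_lt uc] e e0|H].
  near=> k.
  have fk : u k \is a fin_num by near: k.
  rewrite -(fineK fk) lte_fin -[X in X < _]ger0_norm ?fine_ge0//.
  by rewrite -normrN -sub0r; near: k; exact: uc.
apply/fine_cvgP; split.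
  near=> k; rewrite ge0_fin_numE// (@lt_trans _ _ 1%:E) ?ltry//.
  by near: k; exact: H.
apply/cvgrPdist_lt => e e0; near=> k.
rewrite sub0r normrN ger0_norm ?fine_ge0//.
have uke : (u k < e%:E)%E by near: k; exact: H.
by rewrite -lte_fin fineK// ge0_fin_numE// (lt_trans uke) ?ltry.
Unshelve. all: by end_near. Qed.

Lemma Lpnorm2_lt f (e : R) : 0 < e ->
  (Lpnorm 2%:E f < e%:E)%E = (sqnorm f < (e ^+ 2)%:E)%E.
Proof.
move=> e0; rewrite -sqr_Lpnorm2.
have : (0 <= Lpnorm 2%:E f)%E by exact: Lnorm_ge0.
case: (Lpnorm _ _) => [r| |]//= r0.
  by rewrite powR_mulrn// !lte_fin ltr_pXn2r// nnegrE ltW.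
by rewrite pnatr_eq0.
Qed.

Lemma Lpnorm2_cvg0P (f : nat -> X -> C) :
  Lpnorm 2%:E (f k) @[k --> \oo] --> 0%E <->
  forall e : R, 0 < e -> \forall k \near \oo, (sqnorm (f k) < e%:E)%E.
Proof.
rewrite ge0_cvge0P; last by move=> k; exact: Lnorm_ge0.
split=> H e e0.
  have s0 : 0 < Num.sqrt e by rewrite sqrtr_gt0.
  apply: filterS (H _ s0) => k; rewrite Lpnorm2_lt// sqr_sqrtr//; exact: ltW.
apply: filterS (H (e ^+ 2) _) => [k|]; last by rewrite exprn_gt0.
by rewrite Lpnorm2_lt.
Qed.

Lemma test_function_lincomb a b (w z : X -> C) :
  test_function w -> test_function z -> test_function (lincomb a b w z).
Proof.
move=> [wr wi [M HM]] [zr zi [N HN]]; split.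
- rewrite (_ : re_row _ = fun v => a * re_row w v + b * re_row z v).
    exact: smooth_lincomb.
  by apply/funext => v; rewrite /re_row Re_lincomb.
- rewrite (_ : im_row _ = fun v => a * im_row w v + b * im_row z v).
    exact: smooth_lincomb.
  by apply/funext => v; rewrite /im_row Im_lincomb.
- exists (Num.max M N) => x; rewrite gt_max => /andP[/HM wx /HN zx].
  by rewrite /lincomb wx zx !mulr0 addr0.
Qed.

Lemma grad_lincomb a b (w z : X -> C) j : test_function w -> test_function z ->
  grad (lincomb a b w z) j = lincomb a b (grad w j) (grad z j).
Proof.
move=> [wr wi _] [zr zi _]; apply/funext => x; apply/eqP.
rewrite eq_complex Re_lincomb Im_lincomb /=.
have -> : re_row (lincomb a b w z) = fun v => a * re_row w v + b * re_row z v.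
  by apply/funext => v; rewrite /re_row Re_lincomb.
have -> : im_row (lincomb a b w z) = fun v => a * im_row w v + b * im_row z v.
  by apply/funext => v; rewrite /im_row Im_lincomb.
rewrite !partial_lincomb ?eqxx//.
- by move=> v; exact: (wi [::]).
- by move=> v; exact: (zi [::]).
- by move=> v; exact: (wr [::]).
- by move=> v; exact: (zr [::]).
Qed.

Lemma lincombB T a b (f g f' g' : T -> C) :
  lincomb a b f g \- lincomb a b f' g' = lincomb a b (f \- f') (g \- g').
Proof. by apply/funext => x; rewrite /lincomb/=; ring. Qed.

Lemma sqnorm_lincomb_near a b (f g : nat -> X -> C) :
  (forall k, cmeasurable (f k)) -> (forall k, cmeasurable (g k)) ->
  (forall e : R, 0 < e -> \forall k \near \oo, (sqnorm (f k) < e%:E)%E) ->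
  (forall e : R, 0 < e -> \forall k \near \oo, (sqnorm (g k) < e%:E)%E) ->
  forall e : R, 0 < e -> \forall k \near \oo, (sqnorm (lincomb a b (f k) (g k)) < e%:E)%E.
Proof.
move=> mf mg Hf Hg e e0.
(* The coefficients of [sqnorm_lincomb_le], plus 1 so that [c] is positive and the final inequality
   strict. *)
pose c := 2 * a ^+ 2 + 2 * b ^+ 2 + 1.
have a0 := sqr_ge0 a; have b0 := sqr_ge0 b.
have c0 : 0 < c by rewrite /c; lra.
have ec0 : 0 < e / c by rewrite divr_gt0.
near=> k.
have fk : (sqnorm (f k) < (e / c)%:E)%E by near: k; exact: Hf.
have gk : (sqnorm (g k) < (e / c)%:E)%E by near: k; exact: Hg.
apply: (le_lt_trans (sqnorm_lincomb_le _ _ (mf k) (mg k))).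
apply: (@le_lt_trans _ _ ((2 * a ^+ 2)%:E * (e / c)%:E + (2 * b ^+ 2)%:E * (e / c)%:E)%E).
  have h (d : R) : (0 <= (2 * d ^+ 2)%:E)%E by rewrite lee_fin mulr_ge0 ?sqr_ge0.
  by apply: leeD; apply: lee_wpmul2l; rewrite ?h//; exact: ltW.
rewrite -!EFinM -EFinD lte_fin -mulrDl mulrA ltr_pdivrMr// mulrC.
by rewrite ltr_pM2l// /c; lra.
Unshelve. all: by end_near. Qed.

Lemma sqnorm_cauchy (f : nat -> X -> C) (f0 : X -> C) :
  (forall k, cmeasurable (f k)) -> cmeasurable f0 ->
  (forall e : R, 0 < e -> \forall k \near \oo, (sqnorm (f k \- f0)%R < e%:E)%E) ->
  forall e : R, 0 < e -> exists N : nat, forall k l, (N <= k)%N -> (N <= l)%N ->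
    (norm2 (f k \- f l) ^+ 2 < e).
Proof.
move=> mf m0 H e e0.
(* The difference of two terms is compared through [f0]; [sqnorm_lincomb_le] doubles each of the two
   errors, hence a quarter for each. *)
have e4 : 0 < e / 4 by rewrite divr_gt0.
have [N _ HN] := H _ e4; exists N => k l Nk Nl.
have mB k' : cmeasurable (f k' \- f0).
  by rewrite subf_lincomb; exact: cmeasurable_lincomb.
have -> : f k \- f l = lincomb 1 (-1) (f k \- f0) (f l \- f0).
  by rewrite -subf_lincomb; apply/funext => x /=; ring.
have fe : (sqnorm (lincomb 1 (-1) (f k \- f0) (f l \- f0))%R < e%:E)%E.
  apply: (le_lt_trans (sqnorm_lincomb_le _ _ (mB k) (mB l))).
  rewrite sqrrN expr1n mulr1.
  have := HN _ Nk; have := HN _ Nl => /=.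
  have := sqnorm_ge0 (f k \- f0); have := sqnorm_ge0 (f l \- f0).
  case: (sqnorm _) => [r| |]//; case: (sqnorm _) => [s| |]//.
  rewrite -[X in _ -> _ -> _ -> _ -> (X < _)%E]/((2 * s + 2 * r)%:E).
  rewrite !lee_fin !lte_fin; lra.
rewrite sqr_norm2 -lte_fin fineK// ge0_fin_numE ?sqnorm_ge0//.
by rewrite (lt_trans fe)// ltry.
Qed.

(** Combining the approximating test functions gives the three L^2 limits. The Cauchy clause is then
    recovered from these limits, with [lam] estimated by its absolute value. *)
Lemma H1_lincomb lam a b (u v : H1 n lam) : exists w : H1 n lam,
  h1val w = lincomb a b u v /\
  h1grad w = (fun j => lincomb a b (h1grad u j) (h1grad v j)).
Proof.
have [wu [tu _ wu0 wu1 wu2]] := h1_completion u.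
have [wv [tv _ wv0 wv1 wv2]] := h1_completion v.
pose w k := lincomb a b (wu k) (wv k).
have tw k : test_function (w k) by exact: test_function_lincomb.
have mB (f g : X -> C) : cmeasurable f -> cmeasurable g -> cmeasurable (f \- g).
  by move=> mf mg; rewrite subf_lincomb; exact: cmeasurable_lincomb.
have overB (f g : X -> C) : over_abs (f \- g) = over_abs f \- over_abs g.
  by rewrite !subf_lincomb over_abs_lincomb.
pose F := lincomb a b u v.
pose G j := lincomb a b (h1grad u j) (h1grad v j).
have [[mu0 _] [mv0 _]] := (h1val_L2 u, h1val_L2 v).
have L2F : L2 F by apply: in_L2_lincomb; exact: h1val_L2.
have L2G j : L2 (G j) by apply: in_L2_lincomb; exact: h1grad_L2.
have L2O : L2 (over_abs F).
  by rewrite over_abs_lincomb; apply: in_L2_lincomb; exact: h1over_L2.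
have c0 (e : R) : 0 < e -> \forall k \near \oo, (sqnorm (w k \- F)%R < e%:E)%E.
  under eq_near do rewrite lincombB.
  apply: sqnorm_lincomb_near; try exact/Lpnorm2_cvg0P.
  - by move=> k; apply: mB => //; exact: cmeasurable_test_function.
  - by move=> k; apply: mB => //; exact: cmeasurable_test_function.
have c1 j (e : R) : 0 < e -> \forall k \near \oo, (sqnorm (grad (w k) j \- G j)%R < e%:E)%E.
  under eq_near do rewrite grad_lincomb// lincombB.
  apply: sqnorm_lincomb_near; try exact/Lpnorm2_cvg0P.
  - move=> k; apply: mB; first exact: cmeasurable_grad.
    by have [] := h1grad_L2 u j.
  - move=> k; apply: mB; first exact: cmeasurable_grad.
    by have [] := h1grad_L2 v j.
have c2 (e : R) : 0 < e -> \forall k \near \oo, (sqnorm (over_abs (w k \- F)%R) < e%:E)%E.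
  under eq_near do rewrite lincombB over_abs_lincomb.
  apply: sqnorm_lincomb_near; try exact/Lpnorm2_cvg0P.
  - move=> k; apply/cmeasurable_over_abs/mB => //.
    exact: cmeasurable_test_function.
  - move=> k; apply/cmeasurable_over_abs/mB => //.
    exact: cmeasurable_test_function.
have compl : exists w : nat -> X -> C,
    [/\ forall k, test_function (w k),
        forall e : R, 0 < e -> exists N : nat, forall k l : nat,
          (N <= k)%N -> (N <= l)%N ->
          h1sqr lam (w k \- w l) (fun j => grad (w k) j \- grad (w l) j) < e,
        Lpnorm 2%:E (w k \- F) @[k --> \oo] --> 0%E,
        forall j, Lpnorm 2%:E (grad (w k) j \- G j) @[k --> \oo] --> 0%E &
        Lpnorm 2%:E (over_abs (w k \- F)%R) @[k --> \oo] --> 0%E].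
  exists w; split => //; last 3 first.
  - exact/Lpnorm2_cvg0P.
  - by move=> j; apply/Lpnorm2_cvg0P; exact: c1.
  - exact/Lpnorm2_cvg0P.
  (* [M] counts the [n] gradient terms, the function itself and the weighted term with factor
     [|lam|]; the last 1 is slack. *)
  move=> e e0; pose M := n%:R + 1 + `|lam| + 1 : R.
  have M0 : 0 < M by rewrite /M; have := normr_ge0 lam; have := ler0n R n; lra.
  have eM : 0 < e / M by rewrite divr_gt0.
  have mw k : cmeasurable (w k) by exact: cmeasurable_test_function.
  have [N0 H0] := sqnorm_cauchy mw L2F.1 c0 eM.
  have [N2 H2] : exists N : nat, forall k l, (N <= k)%N -> (N <= l)%N ->
      norm2 (over_abs (w k \- w l)) ^+ 2 < e / M.
    have mo k : cmeasurable (over_abs (w k)) by exact: cmeasurable_over_abs.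
    have [|N2 H2] := sqnorm_cauchy mo L2O.1 _ eM.
      move=> d d0; under eq_near do rewrite -overB; exact: c2.
    by exists N2 => k l Nk Nl; rewrite overB; exact: H2.
  have [N1 H1] : exists N : nat, forall j k l, (N <= k)%N -> (N <= l)%N ->
      norm2 (grad (w k) j \- grad (w l) j) ^+ 2 < e / M.
    have mg j k : cmeasurable (grad (w k) j) by exact: cmeasurable_grad.
    have := fun j => sqnorm_cauchy (mg j) (L2G j).1 (c1 j) eM.
    (* The thresholds of the finitely many components are merged by taking their maximum. *)
    move=> /choice[N1 HN1]; exists (\max_(j < n) N1 j) => j k l Nk Nl.
    by apply: HN1; [apply: leq_trans Nk|apply: leq_trans Nl]; exact: leq_bigmax.
  exists (maxn N0 (maxn N1 N2)) => k l.
  rewrite !geq_max => /and3P[k0 k1 k2] /and3P[l0 l1 l2].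
  have := H0 _ _ k0 l0; have := H2 _ _ k2 l2.
  have {}H1 j := H1 j _ _ k1 l1.
  rewrite /h1sqr /Defs.form => h2 h0.
  have hs : \sum_(j < n) norm2 (grad (w k) j \- grad (w l) j) ^+ 2 <= n%:R * (e / M).
    rewrite (@le_trans _ _ (\sum_(j < n) (e / M)))//.
      by apply: ler_sum => j _; exact: ltW.
    by rewrite sumr_const card_ord mulr_natl.
  have hl : lam * norm2 (over_abs (w k \- w l)) ^+ 2 <= `|lam| * (e / M).
    rewrite (le_trans (ler_norm _))// normrM ler_wpM2l// ger0_norm ?sqr_ge0//.
    exact: ltW.
  have eE : e = n%:R * (e / M) + (e / M) + `|lam| * (e / M) + (e / M).
    by rewrite -{1}(divfK (lt0r_neq0 M0) e) mulrC {1}/M; ring.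
  rewrite [ltRHS]eE; lra.
by exists (MkH1 L2F L2G L2O compl).
Qed.

End H1closed.

(** * The functional P *)

Section Choquard.
Context {R : realType} {n : nat}.
Local Notation C := R[i].
Local Notation X := (Rn R n).
Local Notation cabs := Normc.normc.
Local Notation mu := (leb n : {sigma_finite_measure set X -> \bar R}).
Local Notation Pfun := Defs.Pfun.
Implicit Types (tau alpha p : R) (f g : X -> C) (x y : X).

(** The point lies in a hyperplane on which the first coordinate is fixed, and [0 * +oo = 0] in the
    product measure. In dimension 0 the measure is a Dirac mass, whence [0 < n]. *)
Lemma negligible_point x : (0 < n)%N -> mu.-negligible [set x].
Proof.
case: n x => // m x _.
exists [set y : Rn R m.+1 | tnth y ord0 = tnth x ord0]; split.
- rewrite -[X in measurable X]setTI.
  have mt : measurable_fun setT (fun y : Rn R m.+1 => (tnth y ord0 : R)).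
    exact: measurable_tnth.
  exact: (mt measurableT [set (tnth x ord0 : R)] (measurable_set1 _)).
- rewrite /= /leb_step /pushforward.
  have -> : tcons (n:=m) @^-1` [set y | tnth y ord0 = tnth x ord0] =
      [set tnth x ord0] `*` setT.
    by apply/seteqP; split=> [[a t]|[a t]] /=; [|move=> []].
  transitivity (lebesgue_measure [set (tnth x ord0 : R)] * leb m setT)%E.
    by apply: product_measure1E => //; exact: measurable_set1.
  by rewrite lebesgue_measure_set1 mul0e.
- by move=> y ->.
Qed.

Lemma enorm_ge0 x : 0 <= enorm x. Proof. exact: sqrtr_ge0. Qed.

Lemma enorm_esub_gt0 x y : x <> y -> 0 < enorm (esub x y).
Proof.
move=> xy; rewrite lt_neqAle enorm_ge0 andbT eq_sym sqrtr_eq0 -ltNge.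
rewrite lt_neqAle sumr_ge0 ?andbT; last by move=> j _; exact: sqr_ge0.
apply/eqP => /esym/eqP; rewrite psumr_eq0; last by move=> j _; exact: sqr_ge0.
move=> /allP H; apply: xy; apply: eq_from_tnth => j.
have := H j (mem_index_enum j); rewrite implyTb sqrf_eq0 tnth_mktuple subr_eq0.
by move/eqP.
Qed.

Definition origin : X := [tuple (0 : R) | j < n].

Lemma enorm_gt0 x : x <> origin -> 0 < enorm x.
Proof.
move=> /enorm_esub_gt0; congr (0 < Num.sqrt _); apply: eq_bigr => j _.
by rewrite !tnth_mktuple subr0.
Qed.

Lemma riesz_gt0 alpha x : 0 < alpha < n%:R -> 0 < enorm x -> 0 < riesz alpha x.
Proof.
move=> /andP[a0 an] x0; rewrite mulr_gt0 ?powR_gt0// divr_gt0 ?Gamma_gt0//.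
  by rewrite divr_gt0// subr_gt0.
by rewrite !mulr_gt0 ?Gamma_gt0 ?powR_gt0 ?pi_gt0// divr_gt0.
Qed.

Lemma riesz_ge0 alpha x : 0 < alpha < n%:R -> 0 <= riesz alpha x.
Proof.
move=> an; have := enorm_ge0 x; rewrite le_eqVlt => /orP[/eqP x0|x0].
  (* At the origin the power with nonzero exponent [alpha - n] takes the default value 0. *)
  rewrite /riesz -x0 powR0 ?mulr0// subr_eq0 lt_eqF//.
  by case/andP: an.
exact/ltW/riesz_gt0.
Qed.

Lemma measurable_weight tau p f : cmeasurable f ->
  measurable_fun [set: X] (fun x => enorm x `^ (- tau) * cabs (f x) `^ p).
Proof.
move=> mf; apply: measurable_funM.
  by apply: (measurableT_comp (measurable_powR _)); exact: measurable_enorm.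
by apply: (measurableT_comp (measurable_powR _)); exact: measurable_normc.
Qed.

Lemma weight_ge0 tau p f x : 0 <= enorm x `^ (- tau) * cabs (f x) `^ p.
Proof. by rewrite mulr_ge0 ?powR_ge0. Qed.

Lemma weight_eq0 tau p f x : p != 0 -> 0 < enorm x ->
  enorm x `^ (- tau) * cabs (f x) `^ p = 0 -> f x = 0.
Proof.
move=> p0 x0 /eqP; rewrite mulf_eq0 !powR_eq0 p0 andbT gt_eqF//=.
by move=> /eqP/Normc.eq0_normc.
Qed.

Lemma measurable_riesz_esub alpha :
  measurable_fun [set: X * X] (fun z => riesz alpha (esub z.1 z.2)).
Proof.
apply: measurable_funM => //; apply: (measurableT_comp (measurable_powR _)).
rewrite /enorm; apply: (@measurableT_comp _ _ _ _ _ _ (@Num.sqrt R)).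
  by apply: continuous_measurable_fun; exact: sqrt_continuous.
apply: measurable_sum => j; apply: measurable_funX.
under eq_fun do rewrite tnth_mktuple.
apply: measurable_funB.
  by apply: (measurableT_comp (measurable_tnth j)).
by apply: (measurableT_comp (measurable_tnth j)).
Qed.

(** * The potential and the functional P of a fixed measurable function *)

Section potential.
Variables (tau alpha p : R) (f : X -> C).
Hypotheses (an : 0 < alpha < n%:R) (mf : cmeasurable f).

Lemma measurable_potential : measurable_fun [set: X] (potential tau alpha p f).
Proof.
pose K (z : X * X) := (riesz alpha (esub z.1 z.2) *
  (enorm z.2 `^ (- tau) * cabs (f z.2) `^ p))%:E.
apply: (@measurable_fun_fubini_tonelli_F _ _ _ _ _ mu K) => [|z].
  apply: measurableT_comp => //; apply: measurable_funM.
    exact: measurable_riesz_esub.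
  exact: (measurableT_comp (measurable_weight tau p mf)).
by rewrite lee_fin mulr_ge0 ?weight_ge0 ?riesz_ge0.
Qed.

Lemma potential_ge0 x : (0 <= potential tau alpha p f x)%E.
Proof.
by apply: integral_ge0 => y _; rewrite lee_fin mulr_ge0 ?weight_ge0 ?riesz_ge0.
Qed.

Let P x := ((enorm x `^ (- tau) * cabs (f x) `^ p)%:E * potential tau alpha p f x)%E.

Lemma measurable_Pfun_integrand : measurable_fun [set: X] P.
Proof.
apply: emeasurable_funM; last exact: measurable_potential.
by apply: measurableT_comp => //; exact: measurable_weight.
Qed.

Lemma Pfun_integrand_ge0 x : (0 <= P x)%E.
Proof. by rewrite mule_ge0 ?potential_ge0// lee_fin weight_ge0. Qed.

Lemma Pfun_ge0 : (0 <= Pfun tau alpha p f)%E.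
Proof. by apply: integral_ge0 => x _; exact: Pfun_integrand_ge0. Qed.

Lemma Pfun_eq0 : p != 0 -> ae_equal f (cst 0) -> Pfun tau alpha p f = 0%E.
Proof.
move=> p0 [N [mN N0 sub]].
have : (\int[mu]_x `|P x| = 0)%E.
  apply/ae_eq_integral_abs => //; first exact: measurable_Pfun_integrand.
  exists N; split => // x /= H; apply: sub => /= H'; apply: H => _.
  by rewrite /P H'// Normc.normc0 powR0// mulr0 mul0e.
move=> <-; apply: eq_integral => x _.
by rewrite gee0_abs// Pfun_integrand_ge0.
Qed.

(* If P vanishes then almost everywhere f = 0 or the potential vanishes; and
   a zero of the potential at one single point already forces f = 0 a.e. *)
Lemma Pfun_gt0 : (0 < n)%N -> p != 0 -> nonzero f -> (0 < Pfun tau alpha p f)%E.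
Proof.
move=> n0 p0 nf; rewrite lt_neqAle Pfun_ge0 andbT; apply/eqP => /esym P0.
(* Two points are discarded as negligible: the origin, where the weight is singular, and [x], where
   the kernel is. Elsewhere both are positive. *)
have ae_off x (g : X -> Prop) : (forall y, y <> origin -> y <> x -> g y -> f y = 0) ->
    {ae mu, forall y, g y} -> ae_equal f (cst 0).
  move=> H gae.
  have no : {ae mu, forall y, y <> origin}.
    have [N [mN N0 sub]] := negligible_point origin n0.
    by exists N; split => // y /= /contrapT yo; exact: sub.
  have nx : {ae mu, forall y, y <> x}.
    have [N [mN N0 sub]] := negligible_point x n0.
    by exists N; split => // y /= /contrapT yo; exact: sub.
  by apply: filterS3 gae no nx => y gy yo yx _; exact: H.
have Pae : ae_eq mu setT P (cst 0%E).
  apply/ae_eq_integral_abs => //; first exact: measurable_Pfun_integrand.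
  by rewrite -[RHS]P0; apply: eq_integral => x _; rewrite gee0_abs// Pfun_integrand_ge0.
have [[x potx]|npot] := pselect (exists x, potential tau alpha p f x = 0%E).
  apply: nf.
  have : ae_eq mu setT (fun y => (riesz alpha (esub x y) *
      (enorm y `^ (- tau) * cabs (f y) `^ p))%:E) (cst 0%E).
    apply/ae_eq_integral_abs => //.
      apply: measurableT_comp => //; apply: measurable_funM; last exact: measurable_weight.
      have : measurable_fun [set: X] (fun y : X => (x, y)) by exact: pair1_measurable.
      by move=> /(measurableT_comp (measurable_riesz_esub alpha)).
    rewrite -[RHS]potx; apply: eq_integral => y _.
    by rewrite gee0_abs// lee_fin mulr_ge0 ?weight_ge0 ?riesz_ge0.
  apply: (ae_off x) => y yo yx /(_ I)/eqP.
  rewrite eqe mulf_eq0 gt_eqF/= ?riesz_gt0 ?enorm_esub_gt0//; last exact/nesym.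
  by move=> /eqP/weight_eq0; apply => //; exact: enorm_gt0.
apply: nf; apply: (ae_off origin) Pae => y yo _ /(_ I)/eqP.
rewrite mule_eq0 => /orP[|/eqP py]; last by case: npot; exists y.
by rewrite eqe => /eqP/weight_eq0; apply => //; exact: enorm_gt0.
Qed.

(** The powers of the modulus add up to [p]; zeros of [f] are treated apart, where both integrands
    vanish because [p] is positive. *)
Lemma abs_pairing_diag : 0 < p ->
  abs_pairing tau alpha p f f = Pfun tau alpha p f.
Proof.
move=> p0; apply: eq_integral => x _; congr (_%:E * _)%E.
have := normc_ge0 (f x); set c := cabs (f x).
rewrite -!mulrA le_eqVlt => /orP[/eqP<-|c0].
  by rewrite mulr0 mulr0 powR0 ?gt_eqF.
congr (_ * _); rewrite -expr2 -powR_mulrn ?ltW// -powRD ?subrK//.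
by rewrite (gt_eqF c0) implybT.
Qed.

(** [nonlinearity] replaces an infinite potential by 0, whereas [Pfun] keeps it. Finiteness of
    [Pfun] makes the two integrands agree almost everywhere. *)
Lemma Re_inner_nonlinearity : 0 < p -> (Pfun tau alpha p f < +oo)%E ->
  complex.Re (inner (nonlinearity tau alpha p f) f) = fine (Pfun tau alpha p f).
Proof.
move=> p0 Pfin; rewrite /inner /cintegral /= /Rintegral; congr fine.
have iP : mu.-integrable setT P.
  apply/integrableP; split; first exact: measurable_Pfun_integrand.
  rewrite (le_lt_trans _ Pfin)// le_eqVlt; apply/orP; left; apply/eqP.
  by apply: eq_integral => x _; rewrite gee0_abs// Pfun_integrand_ge0.
transitivity (\int[mu]_x (enorm x `^ (- tau) * cabs (f x) `^ p *
    fine (potential tau alpha p f x))%:E)%E.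
  apply: eq_integral => x _; congr EFin.
  rewrite /nonlinearity; have := sqr_normcE (f x); have := normc_ge0 (f x).
  set c := cabs (f x); case: (f x) => a b /= c0 cE.
  have -> : c `^ p = c `^ (p - 2) * c ^+ 2.
    move: c0; rewrite le_eqVlt => /orP[/eqP<-|c0].
      by rewrite expr0n/= mulr0 powR0 ?gt_eqF.
    rewrite -powR_mulrn ?ltW// -powRD ?subrK//.
    by rewrite (gt_eqF c0) implybT.
  by rewrite cE; ring.
apply: ae_eq_integral => //.
- apply: measurableT_comp => //; apply: measurable_funM.
    exact: measurable_weight.
  by apply: measurableT_comp => //; exact: measurable_potential.
- exact: measurable_Pfun_integrand.
(* Almost everywhere the product of weight and potential is finite: either the weight is 0 and both
   sides vanish, or it is positive and the potential is finite. *)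
have := integrable_ae measurableT iP; apply: filterS => x /(_ I) + _.
rewrite /P; have := weight_ge0 tau p f x; set w := _ * _.
rewrite le_eqVlt => /orP[/eqP<-|w0]; first by rewrite mul0r mul0e.
have := potential_ge0 x; case: (potential _ _ _ _ x) => [r| |]//= _.
by rewrite gt0_muley.
Qed.

End potential.

Lemma Re_inner_diag f : complex.Re (inner f f) = norm2 f ^+ 2.
Proof.
rewrite sqr_norm2 /inner /cintegral/= /Rintegral; congr fine.
apply: eq_integral => x _; rewrite sqr_normcE.
by case: (f x) => a b /=; congr EFin; ring.
Qed.

Lemma Re_sesq_diag (lam : R) (u : H1 n lam) :
  complex.Re (sesq u u) = Defs.form lam u (h1grad u).
Proof.
have ReD (a b : C) : complex.Re (a + b) = complex.Re a + complex.Re b.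
  by case: a; case: b.
rewrite /sesq /Defs.form ReD; congr (_ + _).
  rewrite (big_morph _ ReD (erefl : complex.Re 0 = 0)).
  by apply: eq_bigr => j _; exact: Re_inner_diag.
rewrite -Re_inner_diag; case: (inner _ _) => a b /=.
by rewrite mul0r subr0.
Qed.

End Choquard.

(** * Ground states and trapping *)

(** For [a > 0], the values [s = - b], [t = a] turn the polynomial into [a * (a * c - b ^+ 2)]. *)
Lemma discriminant_le (R : realFieldType) (a b c : R) :
  (forall s t, 0 <= s ^+ 2 * a + 2 * s * t * b + t ^+ 2 * c) -> b ^+ 2 <= a * c.
Proof.
move=> H.
have a0 : 0 <= a by have := H 1 0; lra.
have c0 : 0 <= c by have := H 0 1; lra.
have [a_eq0|a_neq0] := eqVneq a 0; last first.
  have ap : 0 < a by rewrite lt_neqAle eq_sym a_neq0.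
  rewrite -subr_ge0 -(pmulr_rge0 _ ap).
  by have := H (- b) a; congr (0 <= _); ring.
have [->|b0] := eqVneq b 0; first by rewrite a_eq0 mul0r expr0n.
(* When [a = 0] and [b != 0] the polynomial is affine in [s]; this choice makes it [- c - 2], which
   is negative. *)
have := H (- (c + 1) / b) 1.
have -> : (- (c + 1) / b) ^+ 2 * a + 2 * (- (c + 1) / b) * 1 * b + 1 ^+ 2 * c =
    - c - 2 by rewrite a_eq0; field.
lra.
Qed.

Section GroundState.
Context {R : realType} {n : nat}.
Variables (lam tau alpha p : R).
Hypotheses (n0 : (0 < n)%N) (an : 0 < alpha < n%:R) (p2 : 2 < p).
Local Notation Pfun := Defs.Pfun.
Variable phi : H1 n lam.
Hypothesis gs : ground_state tau alpha p phi.
Local Notation form w := (Defs.form lam w (h1grad w)).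

Let p0 : 0 < p. Proof. by rewrite (lt_trans _ p2). Qed.

Let pn0 : p != 0. Proof. exact: lt0r_neq0. Qed.

Let mval (w : H1 n lam) : cmeasurable w.
Proof. by have [] := h1val_L2 w. Qed.

(** Finiteness is the absolute convergence clause of [elliptic_solution] tested on [phi] itself;
    positivity comes from [phi] being nonzero. *)
Lemma ground_state_Pfun : exists2 r : R, 0 < r & Pfun tau alpha p phi = r%:E.
Proof.
have [nz sol _] := gs; have [+ _] := sol phi.
rewrite abs_pairing_diag//.
have := Pfun_gt0 tau an (mval phi) n0 pn0 nz.
by case: (Pfun _ _ _ _) => [r| |]//; rewrite lte_fin => r0 _; exists r.
Qed.

(** The Nehari identity: the real part of the equation tested on [phi]. *)
Lemma ground_state_form : form phi = fine (Pfun tau alpha p phi).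
Proof.
have [_ sol _] := gs; have [fin eq] := sol phi.
rewrite -Re_sesq_diag eq Re_inner_nonlinearity//.
by move: fin; rewrite abs_pairing_diag.
Qed.

Lemma ground_state_form_gt0 : 0 < form phi.
Proof. by rewrite ground_state_form; have [r r0 ->] := ground_state_Pfun. Qed.

Lemma sqrtK_ground_state_gt0 : 0 < sqrtK_norm phi.
Proof. by rewrite sqrtr_gt0 ground_state_form_gt0. Qed.

Lemma energy_ground_state : energy tau alpha p phi = (1 - p^-1) * form phi.
Proof.
rewrite /energy /sqrtK_norm sqr_sqrtr ?ltW ?ground_state_form_gt0//.
by rewrite -ground_state_form mulrBl mul1r.
Qed.

Lemma energy_ground_state_gt0 : 0 < energy tau alpha p phi.
Proof.
rewrite energy_ground_state mulr_gt0 ?ground_state_form_gt0// subr_gt0.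
by rewrite invf_lt1// (lt_trans _ p2)// ltr1n.
Qed.

Lemma quotient_ground_state_gt0 : (0 < quotient tau alpha p phi)%E.
Proof.
rewrite /quotient; have [r r0 ->] := ground_state_Pfun.
rewrite inver gt_eqF// -EFinM lte_fin divr_gt0// powR_gt0//.
exact: sqrtK_ground_state_gt0.
Qed.

(* A minimizer of positive quotient forbids negative values of the form, which
   would make [sqrtK_norm], hence the quotient, vanish: Hardy's inequality is
   thus not needed. *)
Lemma form_ge0 (w : H1 n lam) : 0 <= form w.
Proof.
(* Minimality says nothing about a null [w]; there the weighted term vanishes and the gradient terms
   are squares. *)
have [wz|wnz] := pselect (ae_equal w (cst 0)).
  rewrite /Defs.form addr_ge0//; first by apply: sumr_ge0 => j _; exact: sqr_ge0.
  suff -> : norm2 (over_abs w) ^+ 2 = 0 by rewrite mulr0.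
  rewrite sqr_norm2 (sqnorm_ae_eq (g := cst 0)).
  - rewrite /sqnorm integral0_eq// => x _.
    by rewrite Normc.normc0 expr0n.
  - by have [] := h1over_L2 w.
  - by split; exact: measurable_cst.
  have [N [mN N0 sub]] := wz; exists N; split => // x /= H; apply: sub => /= H'.
  by apply: H => _; rewrite /over_abs H'// mulr0.
rewrite leNgt; apply/negP => fw; have [_ _ /(_ w wnz)] := gs.
have -> : quotient tau alpha p w = 0%E.
  rewrite /quotient /sqrtK_norm ler0_sqrtr ?ltW// powR0 ?mul0e//.
  by rewrite mulf_neq0// pnatr_eq0.
by rewrite leNgt quotient_ground_state_gt0.
Qed.

Lemma energy_ge_ground_state (w : H1 n lam) :
  sqrtK_norm w = sqrtK_norm phi -> energy tau alpha p phi <= energy tau alpha p w.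
Proof.
move=> wphi.
suff Pw : fine (Pfun tau alpha p w) <= fine (Pfun tau alpha p phi).
  apply: lerB; first by rewrite wphi.
  by apply: ler_wpM2l => //; rewrite invr_ge0 ltW.
have [r r0 Pphi] := ground_state_Pfun; rewrite Pphi /=.
have [wz|wnz] := pselect (ae_equal w (cst 0)).
  by rewrite Pfun_eq0//=; exact: ltW.
have [_ _ /(_ w wnz)] := gs; rewrite /quotient wphi Pphi.
have c0 : 0 < sqrtK_norm phi `^ (2 * p).
  by rewrite powR_gt0// sqrtK_ground_state_gt0.
have := Pfun_ge0 tau p w an.
(* An infinite [Pfun] becomes 0 under [fine], and for [s = 0] the quotient is [+oo]; both cases are
   immediate. Only a finite positive [s] calls on minimality, where equal numerators leave a
   comparison of inverses. *)
case: (Pfun _ _ _ _) => [s| |]//= s0; last by move=> _; exact: ltW.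
have [->|sn0] := eqVneq s 0; first by move=> _; exact: ltW.
have sp : 0 < s by rewrite lt_neqAle eq_sym sn0.
rewrite !inver (negbTE sn0) gt_eqF// -!EFinM lee_fin ler_pM2l//.
by rewrite lef_pV2.
Qed.

(** A reverse triangle inequality, from Cauchy-Schwarz for the form; the L^2 part of [h1dist] only
    enlarges the right-hand side. *)
Lemma sqrtK_norm_dist_le (u v : H1 n lam) :
  `|sqrtK_norm u - sqrtK_norm v| <= h1dist u v.
Proof.
have fE a b : Defs.form lam (lincomb a b u v)
    (fun j => lincomb a b (h1grad u j) (h1grad v j)) =
    a ^+ 2 * form u + 2 * a * b * form_dot lam u v (h1grad u) (h1grad v)
    + b ^+ 2 * form v.
  by apply: form_lincomb; [exact: h1over_L2|exact: h1over_L2|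
    exact: h1grad_L2|exact: h1grad_L2].
have := discriminant_le (a := form u) (c := form v)
  (b := form_dot lam u v (h1grad u) (h1grad v)).
have : Defs.form lam (u \- v) (fun j => h1grad u j \- h1grad v j) =
    form u - 2 * form_dot lam u v (h1grad u) (h1grad v) + form v.
  rewrite subf_lincomb; under [X in Defs.form _ _ X]eq_fun do rewrite subf_lincomb.
  by rewrite fE; ring.
rewrite /h1dist /h1sqr; move=> -> disc.
have {}disc := disc _; have u0 := form_ge0 u; have v0 := form_ge0 v.
have {}disc : form_dot lam u v (h1grad u) (h1grad v) ^+ 2 <= form u * form v.
  apply: disc => s t; rewrite -fE.
  (* [form_ge0] speaks of elements of [H1], so the combination is first realized as one. *)
  by have [w [<- <-]] := H1_lincomb s t u v; exact: form_ge0.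
have B : form_dot lam u v (h1grad u) (h1grad v) <= sqrtK_norm u * sqrtK_norm v.
  rewrite /sqrtK_norm -sqrtrM// (le_trans (ler_norm _))// -sqrtr_sqr ler_wsqrtr//.
rewrite -sqrtr_sqr ler_wsqrtr// sqrrB /sqrtK_norm !sqr_sqrtr//.
rewrite -/(sqrtK_norm u) -/(sqrtK_norm v).
have := sqr_ge0 (norm2 (u \- v)); rewrite -mulr_natl; lra.
Qed.

(** * Trapping of solutions below the ground state *)

Section trapping.
Variables (u0 : H1 n lam) (T : \bar R) (u : R -> H1 n lam).
Hypotheses (usol : energy_solution tau alpha p u0 T u).
Hypotheses (uE : energy tau alpha p u0 < energy tau alpha p phi).
Hypotheses (uK : sqrtK_norm u0 < sqrtK_norm phi).

(** Reaching the threshold by time [t] would, by the intermediate value theorem, produce a time [c]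
    of equality, where the energy is at least that of [phi]; conservation forbids this. *)
Lemma sqrtK_norm_trapped t : lifespan T t -> sqrtK_norm (u t) < sqrtK_norm phi.
Proof.
move=> [t0 tT]; have [[_ uu0] ucont _ _ ucons] := usol.
have u00 : sqrtK_norm (u 0) = sqrtK_norm u0.
  by rewrite /sqrtK_norm (h1eq_form uu0).
have sub s : `[0, t]%classic s -> lifespan T s.
  rewrite /= in_itv/= => /andP[s0 st]; split => //.
  by rewrite (le_lt_trans _ tT)// lee_fin.
rewrite ltNge; apply/negP => phit.
have cont : {within `[0, t], continuous (fun s => sqrtK_norm (u s))}.
  apply/subspace_continuousP => s /sub Ls; apply/cvgrPdist_lt => e e0.
  have /cvgrPdist_lt/(_ e e0) := ucont s Ls.
  (* Continuity in [h1dist] relative to the lifespan restricts to [[0, t]] and dominates the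
     variation of [sqrtK_norm]. *)
  rewrite !near_withinE; apply: filterS => r H /sub/H; apply: le_lt_trans.
  rewrite -[leLHS]/`|sqrtK_norm (u s) - sqrtK_norm (u r)|.
  rewrite sub0r normrN distrC (le_trans (sqrtK_norm_dist_le _ _))//.
  exact: ler_norm.
have [|c /sub Lc uc] := IVT t0 cont (v := sqrtK_norm phi).
  by rewrite u00 ge_min le_max (ltW uK) phit orbT.
have [_ Ec] := ucons _ Lc.
by have := energy_ge_ground_state uc; rewrite Ec leNgt uE.
Qed.

Lemma h1norm_trapped t : lifespan T t ->
  h1norm (u t) <= Num.sqrt (norm2 u0 ^+ 2 + sqrtK_norm phi ^+ 2).
Proof.
move=> Lt; have [_ _ _ _ /(_ t Lt)[mass _]] := usol.
rewrite ler_wsqrtr// /h1sqr mass lerD2l -[leLHS]sqr_sqrtr ?form_ge0//.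
by rewrite ler_pXn2r// ?nnegrE ?sqrtr_ge0// ltW// sqrtK_norm_trapped.
Qed.

End trapping.
End GroundState.

Unset Implicit Arguments.

Theorem corollary1p10 (R : realType) (n : nat) (lam kappa alpha tau p : R)
  (hn : (3 <= n)%N)
  (hlam : - ((n%:R - 2) ^+ 2 / 4) < lam)
  (hkappa : 2 * kappa = n%:R - 2 - Num.sqrt ((n%:R - 2) ^+ 2 + 4 * lam))
  (halpha : 0 < alpha < n%:R)
  (hkappa_lt : 2 * kappa <
     n%:R - 2 - 2 * (n%:R - 2)
       / (3 * n%:R - 2 + 2 * Num.sqrt (9 * n%:R ^+ 2 + 8 * n%:R - 16)))
  (htau_gt : alpha / 2
     - (n%:R + 2 + Num.sqrt (9 * n%:R ^+ 2 + 8 * n%:R - 16)) / 2 < tau)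
  (htau_lt : tau < alpha / 2
     - Num.max (Num.max ((n%:R - 4) / 2) ((n%:R - 4) / n%:R))
               (kappa / (n%:R - 2 - 2 * kappa) - n%:R / 4))
  (hp : p = 1 + (2 - 2 * tau + alpha) / (n%:R - 2))
  (hp2 : 2 < p)
  (phi u0 : H1 n lam)
  (hphi : ground_state tau alpha p phi)
  (hE : energy tau alpha p u0 / energy tau alpha p phi < 1)
  (hK : sqrtK_norm u0 / sqrtK_norm phi < 1)
  (Tmax : \bar R) (u : R -> H1 n lam)
  (hu : maximal_solution tau alpha p u0 Tmax u) :
  (ereal_sup [set (h1norm (u t))%:E | t in lifespan Tmax] < +oo)%E.
Proof.
have n0 : (0 < n)%N by exact: leq_trans hn.
have K0 := sqrtK_ground_state_gt0 n0 halpha hp2 hphi.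
have E0 := energy_ground_state_gt0 n0 halpha hp2 hphi.
have uE : energy tau alpha p u0 < energy tau alpha p phi.
  by move: hE; rewrite ltr_pdivrMr// mul1r.
have uK : sqrtK_norm u0 < sqrtK_norm phi.
  by move: hK; rewrite ltr_pdivrMr// mul1r.
have [usol _] := hu.
(* The bound combines the conserved mass with the ground-state threshold and is independent of
   time. *)
apply: (@le_lt_trans _ _ (Num.sqrt (norm2 u0 ^+ 2 + sqrtK_norm phi ^+ 2))%:E);
  last exact: ltry.
apply: ge_ereal_sup => _ [t Lt <-]; rewrite lee_fin.
exact: (h1norm_trapped n0 halpha hp2 hphi usol uE uK Lt).
Qed.
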